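(* Let $H\in C(\mathbb R^n\times\mathbb R^n)$, $H=H(p,y)$, be such that: for each $y\in\mathbb R^n$, $p\mapsto H(p,y)$ is convex; $\lim_{|p|\to\infty}\inf_{y\in\mathbb R^n}H(p,y)=+\infty$; and, for each $R>0$, $H$ is uniformly continuous and bounded on $B_R\times\mathbb R^n$. Then for each $p\in\mathbb R^n$, $\mu>\overline H(p)$ and $x_0\in\mathbb R^n$, there exists a unique solution $d_{x_0,\mu,p}$ of $$H(p+Du,y)=\mu\quad\text{in }\mathbb R^n\setminus\{x_0\}$$ satisfying $$\liminf_{|y|\to\infty}|y|^{-1}d_{x_0,\mu,p}(y)>0\quad\text{and}\quad d_{x_0,\mu,p}(x_0)=0.$$
   Context: $B_R=\{x\in\mathbb R^n:|x|<R\}$. Equations and inequalities are understood in the viscosity sense; a solution in $\mathbb R^n\setminus\{x_0\}$ is a continuous function on $\mathbb R^n$ which is a viscosity solution in the punctured space $\mathbb R^n\setminus\{x_0\}$. For $p\in\mathbb R^n$, $\overline H(p)$ is defined as the infimum of all $\mu\in\mathbb R$ for which there exists a Lipschitz function $w:\mathbb R^n\to\mathbb R$ with $\lim_{|y|\to\infty}|y|^{-1}w(y)=0$ satisfying $H(p+Dw,y)\le\mu$ in $\mathbb R^n$ in the viscosity sense (equivalently, by convexity, almost everywhere). *)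

(* Defs.v *)
From HB Require Import structures.
From mathcomp Require Import all_boot all_order all_algebra.
From mathcomp Require Import all_classical all_reals all_analysis.

Set Implicit Arguments.
Unset Strict Implicit.
Unset Printing Implicit Defensive.

Import Order.TTheory GRing.Theory Num.Theory.
Import numFieldNormedType.Exports.

Local Open Scope classical_set_scope.
Local Open Scope ring_scope.

(* R^n is 'rV[R]_n. The library norm `|x| on row vectors is the max norm: it
   induces the usual topology and differentials, but |x| in the statement is
   the Euclidean norm, hence the definition below. *)
Definition enorm (R : realType) (n : nat) (x : 'rV[R]_n) : R :=
  Num.sqrt (\sum_(i < n) x ord0 i ^+ 2).

(* The filter of |y| -> oo. *)
Definition at_infty (R : realType) (n : nat) : set_system 'rV[R]_n :=
  filter_from setT (fun M : R => [set y | M < enorm y]).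

Arguments at_infty {R n}.

Global Instance at_infty_filter (R : realType) (n : nat) :
  Filter (@at_infty R n).
Proof.
apply: filter_from_filter; first by exists 0.
by move=> M N _ _; exists (Num.max M N) => // y /=; rewrite gt_max => /andP[].
Qed.

Definition grad (R : realType) (n : nat) (phi : 'rV[R]_n -> R) (y : 'rV[R]_n) :
    'rV[R]_n :=
  \row_i 'D_(delta_mx ord0 i) phi y.

Definition C1_on (R : realType) (n : nat) (Om : set 'rV[R]_n)
    (phi : 'rV[R]_n -> R) : Prop :=
  forall y, Om y -> differentiable phi y /\ {for y, continuous (grad phi)}.

Section Viscosity.
Variables (R : realType) (n : nat).
(* The equation is F(Du, y) = mu on the open set Om. *)
Variables (F : 'rV[R]_n -> 'rV[R]_n -> R) (mu : R) (Om : set 'rV[R]_n).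

Definition viscosity_subsolution (u : 'rV[R]_n -> R) : Prop :=
  forall (phi : 'rV[R]_n -> R) (y : 'rV[R]_n),
    C1_on Om phi -> Om y ->
    (\forall z \near y, u z - phi z <= u y - phi y) ->
    F (grad phi y) y <= mu.

Definition viscosity_supersolution (u : 'rV[R]_n -> R) : Prop :=
  forall (phi : 'rV[R]_n -> R) (y : 'rV[R]_n),
    C1_on Om phi -> Om y ->
    (\forall z \near y, u y - phi y <= u z - phi z) ->
    mu <= F (grad phi y) y.

Definition viscosity_solution (u : 'rV[R]_n -> R) : Prop :=
  viscosity_subsolution u /\ viscosity_supersolution u.

End Viscosity.

Section Hamiltonian.
Variables (R : realType) (n : nat) (H : 'rV[R]_n -> 'rV[R]_n -> R).

Definition coercive : Prop :=
  ereal_inf [set (H p y)%:E | y in setT] @[p --> at_infty] --> +oo%E.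

Definition bounded_on_strips : Prop :=
  forall r : R, 0 < r ->
    exists M : R, forall p y, enorm p < r -> `|H p y| <= M.

Definition unif_continuous_on_strips : Prop :=
  forall r : R, 0 < r -> forall e : R, 0 < e ->
    exists2 delta : R, 0 < delta &
      forall p q y z, enorm p < r -> enorm q < r ->
        enorm (p - q) < delta -> enorm (y - z) < delta ->
        `|H p y - H q z| < e.

(* Taken in \bar R, so that no convention on the infimum of an empty or
   unbounded set of reals intervenes. *)
Definition Hbar (p : 'rV[R]_n) : \bar R :=
  ereal_inf [set mu%:E | mu in [set mu : R |
    exists w : 'rV[R]_n -> R,
      [/\ exists L : R, forall x y, `|w x - w y| <= L * enorm (x - y),
          (enorm y)^-1 * w y @[y --> at_infty] --> 0 &
          viscosity_subsolution (fun q y => H (p + q) y) mu setT w]]].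

End Hamiltonian.

(* Main.v *)
(* A subsolution is tested only with paraboloids touching it from above; for
   continuous Hamiltonians this is equivalent to testing with C^1 functions
   ([qsub_viscosity]), and it makes every test in the proof an explicit algebraic
   inequality.  Coercivity makes subsolutions globally Lipschitz.

   Existence: the pointwise supremum of the subsolutions vanishing at x0 is a
   solution by Perron's method.  It grows linearly because a sublinear strict
   subsolution w stays a subsolution after adding a small multiple of a smoothed
   distance to x0.

   Uniqueness: for two solutions u and v, one proves
   lam u + (1 - lam) w <= v for every lam < 1, and lets lam tend to 1.  The
   comparison is by doubling of variables with a separate copy of the variable
   for u and for w, so that convexity of H is used only at the level of the
   gradients.  The room left by the strictness of w absorbs a small linear growth
   of lam u + (1 - lam) w - v at infinity, hence lam may be increased from 0
   (where v >= 0 near infinity suffices) in small steps. *)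

Require Import Defs.
From mathcomp Require Import all_boot all_order all_algebra.
From mathcomp Require Import all_classical all_reals all_analysis.
From mathcomp Require Import ring lra.
Import Order.TTheory GRing.Theory Num.Theory.
Import numFieldNormedType.Exports.
Local Open Scope classical_set_scope.
Local Open Scope ring_scope.
Set Implicit Arguments.
Unset Strict Implicit.
Unset Printing Implicit Defensive.

(** * Euclidean norm *)

Section Euclidean.
Variables (R : realType) (n : nat).
Implicit Types (x y z : 'rV[R]_n) (c r : R).

Definition dot x y : R := \sum_(i < n) x ord0 i * y ord0 i.

Lemma dotC x y : dot x y = dot y x.
Proof. by apply: eq_bigr => i _; rewrite mulrC. Qed.

Lemma dotDl x y z : dot (x + y) z = dot x z + dot y z.
Proof. by rewrite -big_split/=; apply: eq_bigr => i _; rewrite mxE mulrDl. Qed.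

Lemma dotZl c x y : dot (c *: x) y = c * dot x y.
Proof. by rewrite mulr_sumr; apply: eq_bigr => i _; rewrite mxE mulrA. Qed.

Lemma dotDr x y z : dot x (y + z) = dot x y + dot x z.
Proof. by rewrite dotC dotDl !(dotC x). Qed.

Lemma dotZr c x y : dot x (c *: y) = c * dot x y.
Proof. by rewrite dotC dotZl dotC. Qed.

Lemma dotNl x y : dot (- x) y = - dot x y.
Proof. by rewrite -scaleN1r dotZl mulN1r. Qed.

Lemma dotNr x y : dot x (- y) = - dot x y.
Proof. by rewrite dotC dotNl dotC. Qed.

Lemma dot0l x : dot 0 x = 0.
Proof. by apply: big1 => i _; rewrite mxE mul0r. Qed.

Lemma dotxx_ge0 x : 0 <= dot x x.
Proof. by apply: sumr_ge0 => i _; rewrite -expr2 sqr_ge0. Qed.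

Lemma enormE x : enorm x = Num.sqrt (dot x x).
Proof. by []. Qed.

Lemma enorm_ge0 x : 0 <= enorm x.
Proof. exact: sqrtr_ge0. Qed.

Lemma sqr_enorm x : enorm x ^+ 2 = dot x x.
Proof. by rewrite enormE sqr_sqrtr// dotxx_ge0. Qed.

Lemma enorm0 : enorm (0 : 'rV[R]_n) = 0.
Proof. by rewrite enormE dot0l sqrtr0. Qed.

Lemma enorm0_eq0 x : enorm x = 0 -> x = 0.
Proof.
move=> x0; have : dot x x = 0 by rewrite -sqr_enorm x0 expr0n.
move=> /psumr_eq0P h; apply/rowP => i; rewrite mxE; apply/eqP.
by rewrite -[_ == _]orbb -mulf_eq0 h// => j _; rewrite -expr2 sqr_ge0.
Qed.

Lemma enorm_gt0 x : x != 0 -> 0 < enorm x.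
Proof.
move=> x0; rewrite lt_neqAle enorm_ge0 andbT; apply: contraNneq x0 => x0.
exact/eqP/enorm0_eq0.
Qed.

Lemma enormN x : enorm (- x) = enorm x.
Proof. by rewrite !enormE dotNl dotNr opprK. Qed.

Lemma enormB x y : enorm (x - y) = enorm (y - x).
Proof. by rewrite -enormN opprB. Qed.

Lemma enormZ c x : enorm (c *: x) = `|c| * enorm x.
Proof. by rewrite !enormE dotZl dotZr mulrA -expr2 sqrtrM ?sqr_ge0// sqrtr_sqr. Qed.

Lemma dot_le x y : dot x y <= enorm x * enorm y.
Proof.
have [->|y0] := eqVneq y 0; first by rewrite dotC dot0l enorm0 mulr0.
have [->|x0] := eqVneq x 0; first by rewrite dot0l enorm0 mul0r.
have := dotxx_ge0 (enorm y *: x - enorm x *: y).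
rewrite !(dotDl, dotDr, dotZl, dotZr, dotNl, dotNr) -!sqr_enorm (dotC y x).
have : 0 < enorm x * enorm y by rewrite mulr_gt0 ?enorm_gt0.
move: (enorm x) (enorm y) (dot x y) => a b d ab0 h.
by rewrite -(ler_pM2l ab0); lra.
Qed.

Lemma dot_ge x y : - (enorm x * enorm y) <= dot x y.
Proof. by rewrite lerNl -dotNl (le_trans (dot_le _ _))// enormN. Qed.

Lemma sqr_enormD x y :
  enorm (x + y) ^+ 2 = enorm x ^+ 2 + 2 * dot x y + enorm y ^+ 2.
Proof. by rewrite !sqr_enorm !(dotDl, dotDr) (dotC y x); ring. Qed.

Lemma ler_enormD x y : enorm (x + y) <= enorm x + enorm y.
Proof.
rewrite -(@ler_pXn2r _ 2) ?nnegrE ?addr_ge0 ?enorm_ge0//.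
by rewrite sqr_enormD; have := dot_le x y; lra.
Qed.

Lemma ler_enorm_dist z x y : enorm (x - y) <= enorm (x - z) + enorm (z - y).
Proof. by rewrite (le_trans _ (ler_enormD _ _))// addrA subrK. Qed.

Lemma ler_coord_norm x i : `|x ord0 i| <= `|x|.
Proof.
by rewrite [leRHS]/Num.norm/= mx_normrE; apply/bigmax_geP; right => /=; exists (ord0, i).
Qed.

Lemma ler_norm_enorm x : `|x| <= enorm x.
Proof.
rewrite [leLHS]/Num.norm/= mx_normrE; apply/bigmax_leP; split=> [|[i j] _ /=].
  exact: enorm_ge0.
rewrite (ord1 i) -(@ler_pXn2r _ 2) ?nnegrE ?enorm_ge0// sqr_enorm real_normK ?num_real//.
by rewrite /dot (bigD1 j)//= -expr2 lerDl; apply: sumr_ge0 => k _; rewrite -expr2 sqr_ge0.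
Qed.

Lemma ler_enorm_norm x : enorm x <= n.+1%:R * `|x|.
Proof.
rewrite -(@ler_pXn2r _ 2) ?nnegrE ?mulr_ge0 ?enorm_ge0// sqr_enorm exprMn.
apply: (@le_trans _ _ (\sum_(i < n) `|x| ^+ 2)).
  apply: ler_sum => i _; rewrite -expr2 -(real_normK (num_real _)).
  by rewrite ler_pXn2r ?nnegrE// ler_coord_norm.
rewrite sumr_const card_ord -[_ *+ n]mulr_natl ler_wpM2r ?sqr_ge0//.
by rewrite -natrX ler_nat -mulnn; apply: (leq_trans (leqnSn n)); rewrite leq_pmull.
Qed.

(** The max norm and the Euclidean norm dominate each other up to a constant, so neighbourhoods may
    be handled with Euclidean balls throughout. *)
Lemma nbhs_enormP y (P : set 'rV[R]_n) :
  nbhs y P <-> exists2 r, 0 < r & forall z, enorm (z - y) < r -> P z.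
Proof.
split.
  move=> /nbhs_ballP[r /= r0 rP]; exists r => // z zr; apply: rP.
  rewrite -ball_normE/= distrC; exact: le_lt_trans (ler_norm_enorm _) zr.
move=> [r r0 rP]; apply/nbhs_ballP; exists (r / n.+1%:R); first by rewrite /= divr_gt0.
move=> z; rewrite -ball_normE/= => zr; apply: rP.
apply: le_lt_trans (ler_enorm_norm _) _.
by rewrite mulrC distrC -ltr_pdivlMr.
Qed.

Lemma continuous_enormP (u : 'rV[R]_n -> R) :
  continuous u <-> forall y e, 0 < e ->
    exists2 r, 0 < r & forall z, enorm (z - y) < r -> `|u z - u y| < e.
Proof.
split=> [uc y e e0|h y].
  have /(@cvgrPdist_lt _ _ _ (nbhs y)) /(_ e e0) := uc y.
  move=> /(iffLR (nbhs_enormP _ _))[r r0 rP].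
  by exists r => // z /rP; rewrite distrC.
apply/(@cvgrPdist_lt _ _ _ (nbhs y)) => e e0; apply/nbhs_enormP.
have [r r0 rP] := h y e e0.
by exists r => // z /rP; rewrite distrC.
Qed.

Lemma lipschitz_continuous (u : 'rV[R]_n -> R) c : 0 <= c ->
  (forall x y, u y <= u x + c * enorm (y - x)) -> continuous u.
Proof.
move=> c0 h; apply/continuous_enormP => y e e0.
have c1 : 0 < c + 1 by rewrite ltr_pwDr.
exists (e / (c + 1)); first by rewrite divr_gt0.
move=> z; rewrite ltr_pdivlMr// => ze.
have := h y z; have := h z y; rewrite (enormB y z) ltr_norml.
by have := enorm_ge0 (z - y); move: (enorm _) ze => s; nra.
Qed.

Lemma enormB_continuous y : continuous (fun z : 'rV[R]_n => enorm (z - y)).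
Proof.
apply: (@lipschitz_continuous _ 1) => // x z.
by rewrite mul1r [leRHS]addrC; exact: ler_enorm_dist.
Qed.

Lemma eball_compact y r : compact [set z | enorm (z - y) <= r].
Proof.
apply: bounded_closed_compact.
  exists (r + enorm y); split; first exact: num_real.
  move=> M hM z /= zr; apply: le_trans (ler_norm_enorm _) _.
  apply: le_trans (ltW hM); rewrite -{1}(subrK y z).
  by rewrite (le_trans (ler_enormD _ _))// lerD2r.
have : closed ((fun z => enorm (z - y)) @^-1` [set t | t <= r]).
  by apply: closed_comp => [z _|]; [exact: enormB_continuous|exact: closed_le].
by [].
Qed.

Lemma eball_max (u : 'rV[R]_n -> R) y r : 0 <= r -> continuous u ->
  exists2 z, enorm (z - y) <= r & forall x, enorm (x - y) <= r -> u x <= u z.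
Proof.
move=> r0 uc; have [|||z /set_mem zr zmax] :=
    @compact_EVT_max _ R u [set z | enorm (z - y) <= r].
- by exists y => /=; rewrite subrr enorm0.
- exact: eball_compact.
- exact: continuous_subspaceT.
by exists z => // x xr; apply: zmax; rewrite inE.
Qed.

End Euclidean.
(** Used to pick one radius or small parameter meeting several smallness conditions at once. *)
Lemma exists_pos_lt (R : realFieldType) (s : seq R) :
  all (fun a => 0 < a) s -> exists2 m, 0 < m & all (fun a => m < a) s.
Proof.
elim: s => [_|a s IH /= /andP[a0 /IH[m m0 ms]]]; first by exists 1.
exists (Num.min a m / 2); first by rewrite divr_gt0// lt_min a0.
have h : Num.min a m / 2 < Num.min a m.
  by rewrite ltr_pdivrMr// ltr_pMr ?lt_min ?a0// ltr1n.
rewrite (lt_le_trans h) ?ge_min ?lexx//=.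
apply: sub_all ms => b; apply: lt_trans (lt_le_trans h _).
by rewrite ge_min lexx orbT.
Qed.

(** * Paraboloids and first-order expansions *)

Section Quadratics.
Variables (R : realType) (n : nat).
Implicit Types (x y z q : 'rV[R]_n) (c r : R) (u : 'rV[R]_n -> R).

(** There is no constant term, so [q] is the gradient at the centre and a test reads
    [u y + quad q c y z]. The sign of [c] is free: the same family tests from above and from
    below. *)
Definition quad q c y z : R := dot q (z - y) + c * enorm (z - y) ^+ 2.

Lemma quad_differentiable q c y z : differentiable (quad q c y) z.
Proof.
pose f i (x : 'rV[R]_n) : R := q ord0 i *: (x ord0 i - y ord0 i)
  + c *: ((x ord0 i - y ord0 i) * (x ord0 i - y ord0 i)).
rewrite (_ : quad q c y = \sum_(i < n) f i).
  apply: differentiable_sum => i.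
  have h : differentiable (fun x : 'rV[R]_n => x ord0 i - y ord0 i : R) z.
    by apply: differentiableB; [exact: differentiable_coord|exact: differentiable_cst].
  by apply: differentiableD; apply: differentiableZ => //; exact: differentiableM.
apply/funext => x; rewrite fct_sumE /quad sqr_enorm /dot mulr_sumr -big_split/=.
by apply: eq_bigr => i _; rewrite /f !mxE.
Qed.

Lemma quad_grad q c y z : grad (quad q c y) z = q + (2 * c) *: (z - y).
Proof.
apply/rowP => i; rewrite mxE.
set l := q + _; set v : 'rV[R]_n := delta_mx ord0 i.
have -> : l ord0 i = dot l v.
  rewrite /dot (bigD1 i)//= !mxE !eqxx mulr1 big1 ?addr0// => j ji.
  by rewrite !mxE (negbTE ji) andbF mulr0.
apply: cvg_lim => //.
apply: (@cvg_trans _ ((dot l v + h * (c * enorm v ^+ 2)) @[h --> 0^'])).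
  apply: near_eq_cvg; near=> h.
  have h0 : h != 0 by near: h; exact: nbhs_dnbhs_neq.
  rewrite /= /quad (_ : h *: v + z - y = (z - y) + h *: v); last by rewrite -addrA addrC.
  rewrite sqr_enormD enormZ exprMn real_normK ?num_real// /l.
  rewrite dotDr dotZr dotDl dotZl dotZr.
  move: (dot q _) (enorm _) (dot _ _) (enorm _) (dot _ _) => a b d g k.
  rewrite /GRing.scale/=; by field.
set k := c * _.
have : (fun h => dot l v + h * k) h @[h --> 0^'] --> dot l v + 0 * k.
  by apply: cvgD; [exact: cvg_cst|apply: cvgMr_tmp; exact: nbhs_dnbhs].
by rewrite mul0r addr0.
Unshelve. all: by end_near. Qed.

Lemma quad_continuous q c y : continuous (quad q c y).
Proof. by move=> z; exact/differentiable_continuous/quad_differentiable. Qed.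

Lemma quad_C1 (Om : set 'rV[R]_n) q c y : C1_on Om (quad q c y).
Proof.
move=> z _; split; first exact: quad_differentiable.
rewrite (_ : grad _ = fun x => q + (2 * c) *: (x - y)); last first.
  by apply/funext => x; exact: quad_grad.
apply: (@continuousD _ _ _ (fun=> q) (fun x => (2 * c) *: (x - y))).
  exact: cst_continuous.
apply: (@continuousZ _ _ _ (fun=> 2 * c) (fun x => x - y)).
  exact: cst_continuous.
apply: (@continuousB _ _ _ id (fun=> y)); first by move=> ?; exact: cvg_id.
exact: cst_continuous.
Qed.

Lemma quad_center q c y : quad q c y y = 0.
Proof. by rewrite /quad subrr enorm0 dotC dot0l expr0n mulr0 addr0. Qed.

Lemma quad_grad_center q c y : grad (quad q c y) y = q.
Proof. by rewrite quad_grad subrr scaler0 addr0. Qed.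

Lemma quadN q c y z : quad (- q) (- c) y z = - quad q c y z.
Proof. by rewrite /quad dotNl mulNr opprD. Qed.

(** The second-order part does not depend on the centre. A maximum point found away from [y] thus
    yields a paraboloid test there, with an explicit gradient. *)
Lemma quad_recenter q c y x z :
  quad q c y z = quad q c y x + quad (q + (2 * c) *: (x - y)) c x z.
Proof.
rewrite /quad (_ : z - y = (z - x) + (x - y)); last by rewrite addrA subrK.
by rewrite sqr_enormD (dotDr q) (dotDl q) dotZl (dotC (z - x)); ring.
Qed.

(** The differential is linear, hence given by the partial derivatives collected in [grad]; the max
    norm in its remainder is bounded by the Euclidean one. *)
Lemma differentiable_expansion (phi : 'rV[R]_n -> R) y e :
  differentiable phi y -> 0 < e -> exists2 r, 0 < r & forall z,
    enorm (z - y) < r ->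
    `|phi z - phi y - dot (grad phi y) (z - y)| <= e * enorm (z - y).
Proof.
move=> dphi e0.
have := diff_locally dphi; move=> /eqaddoP/(_ e e0).
move=> /(iffLR (nbhs_enormP _ _))[r r0 rP]; exists r => // z zr.
have /= := rP (z - y); rewrite subr0 => /(_ zr).
move=> h; apply: (@le_trans _ _ (e * `|z - y|)); last first.
  by rewrite ler_pM2l// ler_norm_enorm.
apply: le_trans h; rewrite le_eqVlt; apply/orP; left; apply/eqP; congr `|_|.
rewrite -[RHS]/(phi (z - y + y) - (phi y + 'd phi y (z - y))) subrK opprD addrA.
congr (_ - _).
rewrite [in RHS](row_sum_delta (z - y)) linear_sum/=; apply: eq_bigr => i _.
by rewrite linearZ/= mxE deriveE// mulrC.
Qed.

End Quadratics.
(** * Tests by paraboloids *)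

Section Proximal.
Variables (R : realType) (n : nat).
Implicit Types (F : 'rV[R]_n -> 'rV[R]_n -> R) (x y z q : 'rV[R]_n).
Implicit Types (mu c r : R) (Om : set 'rV[R]_n) (u : 'rV[R]_n -> R).

(** The vectors [q] tested at [y] form the proximal superdifferential of [u]; in [qsuper] they form
    the proximal subdifferential. *)
Definition qsub F mu Om u : Prop := forall y q c r, 0 < r -> Om y ->
  (forall z, enorm (z - y) < r -> u z <= u y + quad q c y z) -> F q y <= mu.

Definition qsuper F mu Om u : Prop := forall y q c r, 0 < r -> Om y ->
  (forall z, enorm (z - y) < r -> u y + quad q c y z <= u z) -> mu <= F q y.

Definition econtinuous F : Prop := forall q y e, 0 < e ->
  exists2 d, 0 < d & forall q' y', enorm (q' - q) < d -> enorm (y' - y) < d ->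
    `|F q' y' - F q y| < e.

Definition eopen Om : Prop := forall y, Om y ->
  exists2 r, 0 < r & forall z, enorm (z - y) < r -> Om z.

(** The Hamiltonian governing [- u]; through it supersolutions become subsolutions, and one touching
    argument serves both. *)
Definition reflect_ham F : 'rV[R]_n -> 'rV[R]_n -> R := fun q y => - F (- q) y.

Lemma econtinuous_reflect F : econtinuous F -> econtinuous (reflect_ham F).
Proof.
move=> Fc q y e /(Fc (- q) y)[d d0 dP]; exists d => // q' y' qq' yy'.
rewrite /reflect_ham -opprD normrN; apply: dP => //.
by rewrite -opprD enormN.
Qed.

Lemma qsuper_reflect F mu Om u :
  qsuper F mu Om u <-> qsub (reflect_ham F) (- mu) Om (fun z => - u z).
Proof.
split=> h y q c r r0 Oy hu.
  rewrite /reflect_ham lerN2; apply: (h y (- q) (- c) r) => // z /hu.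
  by rewrite quadN; lra.
rewrite -lerN2 -[q]opprK; apply: (h y (- q) (- c) r) => // z /hu.
by rewrite quadN; lra.
Qed.

Lemma viscosity_qsub F mu Om u : viscosity_subsolution F mu Om u -> qsub F mu Om u.
Proof.
move=> h y q c r r0 Oy hu; rewrite -(quad_grad_center q c y); apply: h => //.
  exact: quad_C1.
apply/nbhs_enormP; exists r => // z /hu; rewrite quad_center; lra.
Qed.

Lemma viscosity_qsuper F mu Om u :
  viscosity_supersolution F mu Om u -> qsuper F mu Om u.
Proof.
move=> h y q c r r0 Oy hu; rewrite -(quad_grad_center q c y); apply: h => //.
  exact: quad_C1.
apply/nbhs_enormP; exists r => // z /hu; rewrite quad_center; lra.
Qed.

(* The function [u] minus the paraboloid [q.(z - y) + (2 eta / r) |z - y|^2]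
   exceeds at the centre its values on the sphere, hence has an interior maximum
   where the gradient of the paraboloid is within [4 eta] of [q]. *)
Lemma qsub_touch F mu Om y q : econtinuous F -> eopen Om -> Om y ->
  (forall eta rho, 0 < eta -> 0 < rho -> exists r u,
    [/\ 0 < r <= rho, continuous u, qsub F mu Om u &
      forall z, enorm (z - y) = r ->
        u z < u y + dot q (z - y) + 2 * eta * r]) ->
  F q y <= mu.
Proof.
move=> Fc Oo Oy h; apply/ler_addgt0Pr => e e0.
have [d d0 dP] := Fc q y e e0; have [s s0 sP] := Oo y Oy.
have d8 : 0 < d / 8 by lra.
have [|m m0 /and3P[md ms _]] := @exists_pos_lt R [:: d; s]; first by rewrite /= d0 s0.
have [r [u [/andP[r0 rm] uc us uz]]] := h (d / 8) _ d8 m0.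
have rd := le_lt_trans rm md; have rs := le_lt_trans rm ms.
pose k := 2 * (d / 8) / r.
have [|x xr xmax] := @eball_max R n (fun z => u z - quad q k y z) y r (ltW r0).
  by move=> z; apply: continuousB; [exact: uc|exact: quad_continuous].
have {}xr : enorm (x - y) < r.
  rewrite lt_neqAle xr andbT; apply/eqP => xr'.
  have := xmax y; rewrite subrr enorm0 => /(_ (ltW r0)).
  rewrite quad_center; have := uz x xr'; rewrite /quad xr'.
  have -> : k * r ^+ 2 = 2 * (d / 8) * r by rewrite /k; field; rewrite gt_eqF.
  by lra.
have FP : F (q + (2 * k) *: (x - y)) x <= mu.
  apply: (us x _ k (r - enorm (x - y))); first by rewrite subr_gt0.
    by apply: sP; exact: lt_trans rs.
  move=> z zr; have := xmax z.
  have zy : enorm (z - y) <= r by have := ler_enorm_dist x z y; lra.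
  by move=> /(_ zy); rewrite (quad_recenter q k y x z); lra.
have := dP (q + (2 * k) *: (x - y)) x.
rewrite (_ : _ - q = (2 * k) *: (x - y)) ?enormZ; last by rewrite addrAC subrr add0r.
have k0 : 0 < k by rewrite /k divr_gt0// mulr_gt0.
have k20 : 0 < 2 * k by lra.
rewrite gtr0_norm//.
have kd : 2 * k * enorm (x - y) < d.
  apply: (@lt_trans _ _ (2 * k * r)); first by rewrite ltr_pM2l.
  have -> : 2 * k * r = d / 2 by rewrite /k; field; rewrite gt_eqF.
  by lra.
move=> /(_ kd (lt_trans xr rd)); rewrite ltr_norml => /andP[+ _].
by lra.
Qed.

(** A test function is affine up to an error [eta * r] on a small sphere, which is half of the
    margin [2 * eta * r] allowed in [qsub_touch]. *)
Lemma qsub_viscosity F mu Om u : econtinuous F -> eopen Om -> continuous u ->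
  qsub F mu Om u -> viscosity_subsolution F mu Om u.
Proof.
move=> Fc Oo uc us phi y phiC Oy hu.
apply: (qsub_touch Fc Oo Oy) => eta rho eta0 rho0.
have [dphi _] := phiC y Oy.
have [r r0 rP] := differentiable_expansion dphi eta0.
have [s s0 sP] := iffLR (nbhs_enormP _ _) hu.
have [|m m0 /and4P[m1 m2 m3 _]] := @exists_pos_lt R [:: rho; r; s].
  by rewrite /= rho0 r0 s0.
exists m, u; split=> //; first by rewrite m0 ltW.
move=> z zm; have := sP z; rewrite zm => /(_ m3) h1.
have := rP z; rewrite zm => /(_ m2); rewrite ler_norml => /andP[_].
have : 0 < eta * m by rewrite mulr_gt0.
by move: h1; lra.
Qed.

Lemma qsuper_viscosity F mu Om u : econtinuous F -> eopen Om -> continuous u ->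
  qsuper F mu Om u -> viscosity_supersolution F mu Om u.
Proof.
move=> Fc Oo uc /qsuper_reflect us phi y phiC Oy hu.
rewrite -lerN2 -[grad phi y]opprK.
apply: (qsub_touch (econtinuous_reflect Fc) Oo Oy) => eta rho eta0 rho0.
have [dphi _] := phiC y Oy.
have [r r0 rP] := differentiable_expansion dphi eta0.
have [s s0 sP] := iffLR (nbhs_enormP _ _) hu.
have [|m m0 /and4P[m1 m2 m3 _]] := @exists_pos_lt R [:: rho; r; s].
  by rewrite /= rho0 r0 s0.
exists m, (fun z => - u z); split=> //; first by rewrite m0 ltW.
  by move=> z; apply: continuousN; exact: uc.
move=> z zm; have := sP z; rewrite zm => /(_ m3) h1.
have := rP z; rewrite zm => /(_ m2); rewrite ler_norml => /andP[+ _].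
have : 0 < eta * m by rewrite mulr_gt0.
by rewrite dotNl; move: h1; lra.
Qed.

End Proximal.
(** * A smoothed distance *)

Section SmoothNorm.
Variables (R : realType) (n : nat).
Implicit Types (a x y z q : 'rV[R]_n) (c k r : R).

(** A hyperboloid: for [k > 0] it rounds off the tip of the cone [enorm (z - a)], staying between
    that cone and the cone raised by [k]. *)
Definition sdist k a z : R := Num.sqrt (k ^+ 2 + enorm (z - a) ^+ 2).

Lemma sqr_sdist k a z : sdist k a z ^+ 2 = k ^+ 2 + enorm (z - a) ^+ 2.
Proof. by rewrite /sdist sqr_sqrtr// addr_ge0 ?sqr_ge0. Qed.

Lemma sdist_ge0 k a z : 0 <= sdist k a z.
Proof. exact: sqrtr_ge0. Qed.

Lemma sdist_gt0 k a z : 0 < k -> 0 < sdist k a z.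
Proof. by move=> k0; rewrite sqrtr_gt0 ltr_pwDl ?exprn_gt0// sqr_ge0. Qed.

Lemma sdist_ge_enorm k a z : enorm (z - a) <= sdist k a z.
Proof.
rewrite -(@ler_pXn2r _ 2) ?nnegrE ?enorm_ge0 ?sdist_ge0// sqr_sdist.
by rewrite lerDr sqr_ge0.
Qed.

Lemma sdist_ge k a z : 0 <= k -> k <= sdist k a z.
Proof.
move=> k0; rewrite -(@ler_pXn2r _ 2) ?nnegrE ?sdist_ge0// sqr_sdist.
by rewrite lerDl sqr_ge0.
Qed.

Lemma sdist_le k a z : 0 <= k -> sdist k a z <= k + enorm (z - a).
Proof.
move=> k0; have s0 := enorm_ge0 (z - a).
rewrite -(@ler_pXn2r _ 2) ?nnegrE ?sdist_ge0 ?addr_ge0// sqr_sdist.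
by have := mulr_ge0 k0 s0; nra.
Qed.

Lemma sdist_center k a : 0 <= k -> sdist k a a = k.
Proof.
by move=> k0; rewrite /sdist subrr enorm0 expr0n addr0 sqrtr_sqr ger0_norm.
Qed.

Lemma sqr_enorm_expand a y z :
  enorm (z - a) ^+ 2
  = enorm (y - a) ^+ 2 + 2 * dot (y - a) (z - y) + enorm (z - y) ^+ 2.
Proof. by rewrite -sqr_enormD; congr (enorm _ ^+ 2); rewrite [RHS]addrC addrA subrK. Qed.

Lemma sqrt_tangent (s t : R) : 0 < s -> 0 <= t ->
  Num.sqrt t <= Num.sqrt s + (t - s) / (2 * Num.sqrt s).
Proof.
move=> s0 t0; have ss : 0 < Num.sqrt s by rewrite sqrtr_gt0.
have := sqr_sqrtr (ltW s0); have := sqr_sqrtr t0.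
move: (Num.sqrt t) (Num.sqrt s) ss => b a a0 <- <-.
rewrite -(@ler_pM2r _ (2 * a)); last by lra.
rewrite [leRHS]mulrDl divfK; last by rewrite gt_eqF//; lra.
by have := sqr_ge0 (a - b); nra.
Qed.

(** The square root lies below its tangent, and its argument is exactly quadratic in [z]; composing
    the two gives a paraboloid. *)
Lemma sdist_upper k a y z : 0 < k ->
  sdist k a z <= sdist k a y
    + quad ((sdist k a y)^-1 *: (y - a)) ((2 * sdist k a y)^-1) y z.
Proof.
move=> k0; have b0 := sdist_gt0 a y k0.
have k2 : 0 < k ^+ 2 by rewrite exprn_gt0.
apply: (le_trans (@sqrt_tangent (k ^+ 2 + enorm (y - a) ^+ 2) _ _ _)).
- by rewrite ltr_pwDl// sqr_ge0.
- by rewrite addr_ge0 ?sqr_ge0.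
- rewrite -/(sdist k a y) /quad dotZl (sqr_enorm_expand a y z).
  rewrite le_eqVlt; apply/orP; left; apply/eqP.
  by field; rewrite gt_eqF.
Qed.

(** This is convexity. Multiplied by [sdist k a y], it becomes the Cauchy-Schwarz inequality for the
    vectors [(k, y - a)] and [(k, z - a)]. *)
Lemma sdist_lower k a y z : 0 < k ->
  sdist k a y + dot ((sdist k a y)^-1 *: (y - a)) (z - y) <= sdist k a z.
Proof.
move=> k0; have b0 := sdist_gt0 a y k0; have b1 := sdist_gt0 a z k0.
rewrite -(@ler_pM2l _ (sdist k a y))// mulrDr dotZl mulVKf ?gt_eqF//.
apply: (@le_trans _ _ (k ^+ 2 + enorm (y - a) * enorm (z - a))).
  rewrite -expr2 sqr_sdist (_ : z - y = (z - a) - (y - a)); last first.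
    by rewrite opprB addrA subrK.
  by rewrite (dotDr (y - a)) dotNr -sqr_enorm; have := dot_le (y - a) (z - a); lra.
have s0 := enorm_ge0 (y - a); have t0 := enorm_ge0 (z - a).
rewrite -(@ler_pXn2r _ 2) ?nnegrE//; first last.
- by rewrite mulr_ge0// ltW.
- by rewrite addr_ge0 ?sqr_ge0 ?mulr_ge0.
rewrite exprMn !sqr_sdist.
by have := mulr_ge0 (sqr_ge0 k) (sqr_ge0 (enorm (y - a) - enorm (z - a))); nra.
Qed.

Lemma enorm_grad_sdist k a y : 0 < k -> enorm ((sdist k a y)^-1 *: (y - a)) <= 1.
Proof.
move=> k0; have b0 := sdist_gt0 a y k0.
by rewrite enormZ gtr0_norm ?invr_gt0// ler_pdivrMl// mulr1 sdist_ge_enorm.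
Qed.

Lemma sdist_continuous k a : 0 < k -> continuous (sdist k a).
Proof.
move=> k0; apply: (@lipschitz_continuous _ _ _ 1) => // x y.
have := sdist_lower a y x k0; set g := _ *: _ => h.
have := dot_ge g (x - y); have := enorm_grad_sdist a y k0; rewrite -/g (enormB x).
by have := enorm_ge0 (y - x); nra.
Qed.

End SmoothNorm.
(** * Lipschitz estimate *)

Section LipschitzEstimate.
Variables (R : realType) (n : nat) (F : 'rV[R]_n -> 'rV[R]_n -> R) (mu K : R).
Hypothesis K_gt0 : 0 < K.
Hypothesis F_coercive : forall q y, F q y <= mu -> enorm q <= K.
Variables (x0 : 'rV[R]_n) (u : 'rV[R]_n -> R).
Hypothesis u_continuous : continuous u.
Hypothesis u_sub : qsub F mu (~` [set x0]) u.
Implicit Types (x y z : 'rV[R]_n).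

(** Expanding the right side bounds the squared positive part by a quadratic polynomial in [h], so
    it can enter a test from above. *)
Lemma sqr_pos_part_upper (p h : R) :
  Num.max 0 (p + h) ^+ 2 <= (Num.max 0 p + h) ^+ 2.
Proof.
have [p0|p0] := leP 0 p; have [ph|ph] := leP 0 (p + h) => //.
- by rewrite expr0n sqr_ge0.
- by rewrite add0r ler_pXn2r ?nnegrE//; lra.
- by rewrite expr0n sqr_ge0.
Qed.

(* The first term has slope larger than [K] outside the ball of radius [k]; the
   second one vanishes on the ball of radius [rho], and [A] is chosen so that it
   dominates the oscillation of [u] on a larger sphere. *)
Let barrier (k A rho : R) x z : R :=
  2 * K * sdist k x z + A * Num.max 0 (enorm (z - x) ^+ 2 - rho ^+ 2) ^+ 2.

(** The barrier is radial with gradient [2 * g] times [y - x], and the term with [A] can only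
    increase [g]. Restricting to distance less than 1 lets a quadratic term absorb the quartic
    one. *)
Lemma barrier_upper k A rho x y : 0 < k -> 0 <= A ->
  exists c, exists2 g, K / sdist k x y <= g & forall z, enorm (z - y) < 1 ->
    barrier k A rho x z <= barrier k A rho x y + quad ((2 * g) *: (y - x)) c y z.
Proof.
move=> k0 A0; have b0 := sdist_gt0 x y k0.
pose s := enorm (y - x); pose P := Num.max 0 (s ^+ 2 - rho ^+ 2).
have P0 : 0 <= P by rewrite le_max lexx.
have s0 : 0 <= s := enorm_ge0 _.
pose g := K / sdist k x y + 2 * (A * P).
exists (g + A * (2 * s + 1) ^+ 2), g; first by rewrite lerDl !mulr_ge0.
move=> z z1; have e0 := enorm_ge0 (z - y).
have := sdist_upper x y z k0; rewrite /quad !dotZl invfM /barrier => hb.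
have := sqr_pos_part_upper (s ^+ 2 - rho ^+ 2)
  (2 * dot (y - x) (z - y) + enorm (z - y) ^+ 2).
rewrite (_ : _ - _ + (_ + _) = enorm (z - x) ^+ 2 - rho ^+ 2); last first.
  by rewrite (sqr_enorm_expand x y z) /s; ring.
rewrite -/s -/P; set Pz := Num.max 0 (enorm (z - x) ^+ 2 - _) => hP.
have hd1 := dot_le (y - x) (z - y); have hd2 := dot_ge (y - x) (z - y).
rewrite -/s in hd1 hd2.
set d := dot _ _ in hb hP hd1 hd2 *; set e := enorm (z - y) in z1 e0 hb hP hd1 hd2 *.
have hh : (2 * d + e ^+ 2) ^+ 2 <= (2 * s + 1) ^+ 2 * e ^+ 2.
  rewrite -exprMn -[leLHS]real_normK ?num_real// ler_pXn2r ?nnegrE//; last first.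
    by rewrite mulr_ge0//; lra.
  by rewrite ler_norml; apply/andP; split; nra.
have {hP}hP : A * Pz ^+ 2 <= A * P ^+ 2 + 2 * (A * P) * (2 * d + e ^+ 2)
    + A * (2 * s + 1) ^+ 2 * e ^+ 2.
  have := ler_wpM2l A0 hP; have := ler_wpM2l A0 hh; move: (_ + e ^+ 2) => h.
  by move=> h1 h2; lra.
have {hb}hb : 2 * K * sdist k x z <= 2 * K * sdist k x y
    + K / sdist k x y * (2 * d + e ^+ 2).
  have K2 : 0 <= 2 * K by rewrite mulr_ge0 ?(ltW K_gt0).
  have := ler_wpM2l K2 hb; move: (sdist _ _ _)^-1 => i.
  by rewrite -[2^-1 * i](mulrC i); move=> h; lra.
rewrite /g; move: hP hb; move: (K / _) (A * P) => a b; lra.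
Qed.

(** The two bounds give [2 * enorm (y - x) <= sdist k x y], and squaring gives the claim. So a
    touching point whose slope is compatible with coercivity lies near the vertex [x]. *)
Lemma sdist_max_dist k x y g : 0 < k -> K / sdist k x y <= g ->
  enorm ((2 * g) *: (y - x)) <= K -> enorm (y - x) <= k.
Proof.
move=> k0 Kg; have b0 := sdist_gt0 x y k0.
have s0 := enorm_ge0 (y - x).
have g0 : 0 < g by rewrite (lt_le_trans _ Kg)// divr_gt0.
rewrite enormZ gtr0_norm; last by lra.
move=> h; have : 2 * enorm (y - x) <= sdist k x y.
  have := ler_wpM2r s0 Kg => h1.
  have h2 : K * (2 * enorm (y - x)) <= K * sdist k x y.
    rewrite -(@ler_pM2r _ (sdist k x y)^-1) ?invr_gt0// mulfK ?gt_eqF//.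
    by move: h1; lra.
  by rewrite ler_pM2l in h2.
move=> h1; rewrite -(@ler_pXn2r _ 2) ?nnegrE ?(ltW k0)//.
have : (2 * enorm (y - x)) ^+ 2 <= sdist k x y ^+ 2.
  by rewrite ler_pXn2r ?nnegrE ?mulr_ge0 ?sdist_ge0.
by rewrite sqr_sdist; have := sqr_ge0 k; lra.
Qed.

Lemma barrier_continuous k A rho x : 0 < k -> continuous (barrier k A rho x).
Proof.
move=> k0 z.
apply: (@continuousD _ _ _ (fun z => 2 * K * sdist k x z)
  (fun z => A * Num.max 0 (enorm (z - x) ^+ 2 - rho ^+ 2) ^+ 2)).
  apply: (@continuousM _ _ (fun=> 2 * K) (sdist k x)); first exact: cst_continuous.
  exact: sdist_continuous.
pose f (t : R) := A * Num.max 0 (t ^+ 2 - rho ^+ 2) ^+ 2.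
apply: (@continuous_comp _ _ _ (fun z => enorm (z - x)) f).
  exact: enormB_continuous.
move: (enorm _) => t; rewrite /f.
apply: (@continuousM R R (fun=> A) (fun t => Num.max 0 (t ^+ 2 - rho ^+ 2) ^+ 2)).
  exact: cst_continuous.
apply: (@continuous_comp _ _ _ (fun t : R => Num.max 0 (t ^+ 2 - rho ^+ 2))
  (fun t : R => t ^+ 2)); last exact: exprn_continuous.
apply: (@continuous_max _ _ (fun=> 0) (fun t : R => t ^+ 2 - rho ^+ 2)).
  exact: cst_continuous.
apply: (@continuousB _ _ _ (fun t : R => t ^+ 2) (fun=> rho ^+ 2)).
  exact: exprn_continuous.
exact: cst_continuous.
Qed.

Lemma barrier_center k A rho x : 0 < k -> barrier k A rho x x = 2 * K * k.
Proof.
move=> k0; rewrite /barrier sdist_center ?ltW// subrr enorm0 expr0n/= sub0r.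
by rewrite max_l ?oppr_le0 ?sqr_ge0// expr0n mulr0 addr0.
Qed.

(** Maximise [u] minus the barrier on the ball of radius [r]. The sphere is excluded by [A], the
    point [x0] is settled by the alternative, and elsewhere coercivity forces the maximum within [k]
    of [x], where continuity bounds [u] by [u x + e / 2]. *)
Let lipschitz_step x (rho r : R) : 0 <= rho -> rho < r ->
  r <= enorm (x0 - x) \/ u x0 <= u x + 2 * K * enorm (x0 - x) ->
  forall y, enorm (y - x) <= rho -> u y <= u x + 2 * K * enorm (y - x).
Proof.
move=> rho0 rhor Hx y yrho; apply/ler_addgt0Pr => e e0.
have [d d0 dP] := iffLR (continuous_enormP _) u_continuous x (e / 2) ltac:(lra).
have [|k k0 /and3P[kd ke' _]] := @exists_pos_lt R [:: d; e / (4 * K)].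
  by rewrite /= d0 divr_gt0// mulr_gt0.
have ke : 2 * K * k <= e / 2 by move: ke'; rewrite ltr_pdivlMr ?mulr_gt0//; lra.
have r0 : 0 < r by lra.
have [m mr mmax] := eball_max x (ltW r0) u_continuous.
have rr : 0 < r ^+ 2 - rho ^+ 2 by rewrite subr_sqr mulr_gt0//; lra.
pose A := (u m - u x) / (r ^+ 2 - rho ^+ 2) ^+ 2.
have um : u x <= u m by apply: mmax; rewrite subrr enorm0 ltW.
have A0 : 0 <= A by rewrite divr_ge0 ?sqr_ge0// subr_ge0.
pose phi := barrier k A rho x.
have [|z zr zmax] := @eball_max R n (fun z => u z - phi z) x r (ltW r0).
  by move=> z; apply: continuousB; [exact: u_continuous|exact: barrier_continuous].
have phix : phi x = 2 * K * k by exact: barrier_center.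
have phige w : 2 * K * enorm (w - x) <= phi w.
  rewrite /phi /barrier -[leLHS]addr0; apply: lerD; last by rewrite mulr_ge0// sqr_ge0.
  by rewrite ler_wpM2l ?sdist_ge_enorm// mulr_ge0// ltW.
have phiy : phi y <= 2 * K * (k + enorm (y - x)).
  rewrite /phi /barrier max_l; last first.
    by rewrite subr_le0 ler_pXn2r ?nnegrE ?enorm_ge0.
  rewrite expr0n mulr0 addr0; apply: ler_wpM2l; last exact: sdist_le (ltW k0).
  by rewrite mulr_ge0// ltW.
(* On the sphere the term with [A] equals [u m - u x], which cancels the largest possible gain of
   [u]; strictness comes from [sdist k x z > k]. *)
have {}zr : enorm (z - x) < r.
  rewrite lt_neqAle zr andbT; apply/eqP => zr'.
  have := zmax x; rewrite subrr enorm0 => /(_ (ltW r0)).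
  have := mmax z; rewrite zr' => /(_ (lexx _)).
  rewrite phix /phi /barrier zr' max_r ?(ltW rr)// mulfVK ?gt_eqF ?exprn_gt0//.
  have : 2 * K * k < 2 * K * sdist k x z.
    rewrite ltr_pM2l ?mulr_gt0// -(@ltr_pXn2r _ 2) ?nnegrE ?sdist_ge0 ?ltW//.
    by rewrite sqr_sdist zr' ltrDl exprn_gt0.
  by lra.
have yr : enorm (y - x) <= r by lra.
have := zmax y yr.
have [zx0|zx0] := eqVneq z x0.
  case: Hx => [rx|ux]; first by move: zr; rewrite zx0; lra.
  by have := phige z; rewrite zx0; lra.
move=> hy; have zk : enorm (z - x) <= k.
  have [c [g Kg gP]] := barrier_upper rho x z k0 A0.
  apply: (sdist_max_dist k0 Kg); apply: F_coercive.
  apply: (u_sub (y := z) (q := _) (c := c) (r := Num.min 1 (r - enorm (z - x)))).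
  - by rewrite lt_min ltr01 subr_gt0.
  - by move=> /= /eqP; rewrite (negbTE zx0).
  - move=> w; rewrite lt_min => /andP[w1 wr].
    have wx : enorm (w - x) <= r by have := ler_enorm_dist z w x; lra.
    by have := zmax w wx; have := gP w w1; rewrite -/phi; lra.
have := dP z (le_lt_trans zk kd); rewrite ltr_norml => /andP[_ uz].
have : 2 * K * k <= phi z.
  rewrite /phi /barrier -[leLHS]addr0; apply: lerD; last by rewrite mulr_ge0// sqr_ge0.
  by rewrite ler_wpM2l ?sdist_ge ?(ltW k0)// mulr_ge0// ltW.
by lra.
Qed.

(* The barrier may touch [u] at the exceptional point [x0].  This is excluded on
   balls avoiding [x0]; by continuity they give the estimate at [x0], which is
   what the general case needs. *)
Lemma qsub_lipschitz x y : u y <= u x + 2 * K * enorm (y - x).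
Proof.
have [->|xx0] := eqVneq x y; first by rewrite subrr enorm0 mulr0 addr0.
have hx0 : u x0 <= u x + 2 * K * enorm (x0 - x).
  have [->|] := eqVneq x x0; first by rewrite subrr enorm0 mulr0 addr0.
  rewrite -subr_eq0 => /enorm_gt0; rewrite enormB => s0.
  apply/ler_addgt0Pr => e e0.
  have [d d0 dP] := iffLR (continuous_enormP _) u_continuous x0 e e0.
  set s := enorm _ in s0 *.
  have [|t t0 /and3P[t1 ts' _]] := @exists_pos_lt R [:: 1; d / s].
    by rewrite /= ltr01 divr_gt0.
  have ts : t * s < d by rewrite -ltr_pdivlMr.
  pose w := x0 + t *: (x - x0).
  have wx0 : enorm (w - x0) = t * s.
    by rewrite /w addrAC subrr add0r enormZ gtr0_norm// enormB.
  have wx : enorm (w - x) = (1 - t) * s.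
    rewrite (_ : w - x = (1 - t) *: (x0 - x)).
      by rewrite enormZ gtr0_norm ?subr_gt0// enormB.
    rewrite /w scalerBl scale1r -(opprB x x0) scalerN opprK.
    by rewrite opprB addrAC.
  have hw : u w <= u x + 2 * K * enorm (w - x).
    apply: (@lipschitz_step _ ((1 - t) * s) s) => //.
    - by rewrite mulr_ge0 ?(ltW s0)// subr_ge0 ltW.
    - by rewrite gtr_pMl// gtrDl oppr_lt0.
    - by left; rewrite enormB.
    - by rewrite wx.
  have := dP w; rewrite wx0 => /(_ ts); rewrite ltr_norml => /andP[h _].
  have : 2 * K * enorm (w - x) <= 2 * K * s.
    rewrite ler_pM2l ?mulr_gt0// wx ler_piMl ?(ltW s0)//; lra.
  by lra.
apply: (@lipschitz_step x (enorm (y - x)) (enorm (y - x) + 1)) => //.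
- exact: enorm_ge0.
- by rewrite ltrDl.
- by right.
Qed.

End LipschitzEstimate.
(** * Perron's method *)

Section Perron.
Variables (R : realType) (n : nat) (F : 'rV[R]_n -> 'rV[R]_n -> R) (mu K : R).
Hypothesis F_continuous : econtinuous F.
Hypothesis K_gt0 : 0 < K.
Hypothesis F_coercive : forall q y, F q y <= mu -> enorm q <= K.
Variables (x0 : 'rV[R]_n) (v0 : 'rV[R]_n -> R).
Implicit Types (x y z q : 'rV[R]_n) (u : 'rV[R]_n -> R).

Lemma eopen_punctured : eopen (~` [set x0]).
Proof.
move=> y yx0; exists (enorm (y - x0)).
  by apply: enorm_gt0; rewrite subr_eq0; apply/eqP.
by move=> z /= zy zx0; move: zy; rewrite zx0 enormB ltxx.
Qed.

(** Moving from [z] by [t] times [g - q] separates the linear terms at first order in [t], while the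
    second-order terms differ by order [t ^+ 2]. *)
Lemma quad_le_grad z g q (a b r : R) : 0 < r ->
  (forall w, enorm (w - z) < r -> quad g a z w <= quad q b z w) -> g = q.
Proof.
move=> r0 h; apply/eqP; rewrite -subr_eq0; apply/negP => /negP/enorm_gt0 s0.
set s := enorm _ in s0.
have b1 : 0 < `|b - a| + 1 by rewrite ltr_pwDr.
have [|t t0 /and3P[ts' tb' _]] := @exists_pos_lt R [:: r / s; 1 / (`|b - a| + 1)].
  by rewrite /= !divr_gt0.
have ts : t * s < r by rewrite -ltr_pdivlMr.
have tb : t * (`|b - a| + 1) < 1 by rewrite -ltr_pdivlMr.
have := h (z + t *: (g - q)).
rewrite /quad (_ : _ - z = t *: (g - q)); last by rewrite addrAC subrr add0r.
rewrite enormZ gtr0_norm// -/s => /(_ ts).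
have hs : t * dot g (g - q) - t * dot q (g - q) = t * s ^+ 2.
  by rewrite sqr_enorm (dotDl g) dotNl; ring.
rewrite !dotZr; have hab := ler_norm (b - a) => h1.
have : t * s ^+ 2 <= (b - a) * (t * s) ^+ 2 by lra.
have p0 : 0 < t * s ^+ 2 by rewrite mulr_gt0// exprn_gt0.
have : (b - a) * t < 1 by nra.
by rewrite -(ltr_pM2r p0); lra.
Qed.

(** Continuity is required of the members: by coercivity they then share one Lipschitz constant, so
    their supremum is finite and Lipschitz and no semicontinuous envelope enters. *)
Definition perron_class u : Prop :=
  [/\ continuous u, qsub F mu (~` [set x0]) u & u x0 = 0].
Hypothesis v0_class : perron_class v0.

Definition perron y : R := sup [set u y | u in perron_class].

Lemma perron_class_le u y : perron_class u -> u y <= 2 * K * enorm (y - x0).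
Proof.
move=> [uc us u0]; have := qsub_lipschitz K_gt0 F_coercive uc us x0 y.
by rewrite u0 add0r.
Qed.

Lemma perron_has_sup y : has_sup [set u y | u in perron_class].
Proof.
split; first by exists (v0 y), v0.
by exists (2 * K * enorm (y - x0)) => _ [u uP <-]; exact: perron_class_le.
Qed.

Lemma perron_ge u y : perron_class u -> u y <= perron y.
Proof.
by move=> uP; apply: ub_le_sup; [exact: (perron_has_sup y).2|exists u].
Qed.

Lemma perron_approx y (e : R) : 0 < e ->
  exists2 u, perron_class u & perron y - e < u y.
Proof.
by move=> e0; have [_ [u uP <-] h] := sup_adherent e0 (perron_has_sup y); exists u.
Qed.

Lemma perron_lipschitz x y : perron y <= perron x + 2 * K * enorm (y - x).
Proof.
apply: ge_sup; first by exists (v0 y), v0.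
move=> _ [u uP <-]; have [uc us _] := uP.
apply: (le_trans (qsub_lipschitz K_gt0 F_coercive uc us x y)).
by rewrite lerD2r; exact: perron_ge.
Qed.

Lemma perron_continuous : continuous perron.
Proof.
by apply: (lipschitz_continuous _ perron_lipschitz); rewrite mulr_ge0// ltW.
Qed.

Lemma perron_center : perron x0 = 0.
Proof.
apply/eqP; rewrite eq_le; apply/andP; split.
  apply: ge_sup; first by exists (v0 x0), v0.
  by move=> _ [u [_ _ ->] <-].
by have [_ _ <-] := v0_class; exact: perron_ge.
Qed.

(** The supremum need not be attained, so at each scale [m] a member within [eta * m] of it at [y]
    is used; the margin in [qsub_touch] absorbs this loss together with [c * m ^+ 2]. *)
Lemma perron_qsub : qsub F mu (~` [set x0]) perron.
Proof.
move=> y q c s s0 yx0 hs.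
apply: (qsub_touch F_continuous eopen_punctured yx0) => eta rho eta0 rho0.
pose c1 := `|c| + 1; have c10 : 0 < c1 by rewrite ltr_pwDr.
have [|m m0 /and4P[m1 m2 m3 _]] := @exists_pos_lt R [:: rho; s; eta / c1].
  by rewrite /= rho0 s0 divr_gt0.
have em : 0 < eta * m by rewrite mulr_gt0.
have [u uP uy] := perron_approx y em.
have [uc us _] := uP.
exists m, u; split => //; first by rewrite m0 ltW.
move=> z zm; have := hs z; rewrite zm => /(_ m2); rewrite /quad zm.
have : c * m ^+ 2 <= eta * m.
  rewrite expr2 mulrA ler_pM2r//.
  have := ler_norm c; move: m3; rewrite ltr_pdivlMr// /c1 => h1 h2.
  by nra.
by have := perron_ge z uP; lra.
Qed.

(** Where [P] is strictly on top, a paraboloid touching the maximum from above also touches [P], and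
    so has the gradient of [P]. Elsewhere it touches [u]. *)
Lemma qsub_max (u P : 'rV[R]_n -> R) q c y (tau : R) :
  qsub F mu (~` [set x0]) u ->
  (forall z, P z = tau + quad q c y z) ->
  (forall z, u z < P z -> F (q + (2 * c) *: (z - y)) z <= mu) ->
  qsub F mu (~` [set x0]) (fun z => Num.max (u z) (P z)).
Proof.
move=> us PE PF z g b r r0 zx0 hz.
have [Pu|uP] := leP (P z) (u z).
  apply: (us z g b r) => // w /hz; rewrite (max_l Pu).
  by apply: le_trans; rewrite le_max lexx.
suff <- : q + (2 * c) *: (z - y) = g by exact: PF.
apply: (@quad_le_grad z _ _ c b r) => // w /hz; rewrite (max_r (ltW uP)) ge_max.
by move=> /andP[_]; rewrite !PE (quad_recenter q c y z w); lra.
Qed.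

(* If the supersolution test failed at [y], raising a steep paraboloid slightly
   above the Perron solution near [y] would give a larger element of the class. *)
Lemma perron_qsuper : qsuper F mu (~` [set x0]) perron.
Proof.
move=> y q c s s0 yx0 hs; rewrite leNgt; apply/negP => Fmu.
have [d d0 dP] := @F_continuous q y (mu - F q y) ltac:(lra).
have D0 : 0 < enorm (y - x0) by apply: enorm_gt0; rewrite subr_eq0; apply/eqP.
have [|r r0 /and3P[rs rx0 _]] := @exists_pos_lt R [:: s; enorm (y - x0)].
  by rewrite /= s0 D0.
pose L := enorm q + 2 * K.
have q0 := enorm_ge0 q.
have L0 : 0 <= L by rewrite addr_ge0// mulr_ge0// ltW.
(* Two demands on the opening: [1 - c <= C] puts [P] below the test paraboloid between radii [m] and
   [r], and [L * r + 1 <= C * r ^+ 2] puts it below the cone of slope [2 * K] beyond [r]. *)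
pose C := `|c| + 1 + (L * r + 1) / r ^+ 2.
have Cr : L * r + 1 <= C * r ^+ 2.
  rewrite /C [leRHS]mulrDl divfK ?gt_eqF ?exprn_gt0// lerDr.
  by rewrite mulr_ge0 ?sqr_ge0 ?addr_ge0.
have Cc : - c + 1 <= C.
  have : 0 <= (L * r + 1) / r ^+ 2.
    apply: divr_ge0; last exact: sqr_ge0.
    by apply: addr_ge0 => //; rewrite mulr_ge0// ltW.
  by rewrite /C; have := ler_norm (- c); rewrite normrN; lra.
have C0 : 0 < C.
  have : 0 < C * r ^+ 2 by have := mulr_ge0 L0 (ltW r0); lra.
  by rewrite pmulr_lgt0// exprn_gt0.
(* The raised region lies within [m] of [y]: it avoids [x0] as [m < r], and the gradients of [P]
   there stay within [d] of [q] as [m < d / (2 * C)]. *)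
have [|m m0 /and5P[m1 mr md mC _]] := @exists_pos_lt R [:: 1; r; d; d / (2 * C)].
  by rewrite /= ltr01 r0 d0 divr_gt0// mulr_gt0.
clearbody C.
pose P z := perron y + m ^+ 2 + quad q (- C) y z.
have Pd z : m < enorm (z - y) -> P z <= perron z.
  move=> mz; rewrite /P; have [zr|zr] := leP (enorm (z - y)) r.
    have := hs z (le_lt_trans zr rs); rewrite /quad.
    set t := enorm _ in mz zr *.
    have : m ^+ 2 <= t ^+ 2 by rewrite ler_pXn2r ?nnegrE ?(ltW m0)// ltW// (lt_trans m0).
    have : (1 - c) * t ^+ 2 <= C * t ^+ 2 by rewrite ler_wpM2r ?sqr_ge0//; lra.
    by lra.
  have := perron_lipschitz z y; have := dot_le q (z - y).
  rewrite /quad (enormB y z); set t := enorm (z - y) in mz zr *.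
  have : (L * r + 1) * t ^+ 2 <= C * r ^+ 2 * t ^+ 2 by rewrite ler_wpM2r ?sqr_ge0.
  have : r ^+ 2 * (L * t + 1) <= (L * r + 1) * t ^+ 2.
    have t0 : 0 < t := lt_trans r0 zr.
    have : r * t * L * r <= r * t * L * t.
      by apply: ler_wpM2l; [do !apply: mulr_ge0 => //; exact: ltW|exact: ltW].
    have : r ^+ 2 <= t ^+ 2 by rewrite ler_pXn2r ?nnegrE ?(ltW r0)// ltW// (lt_trans r0).
    by lra.
  move=> h1 h2; have : L * t + 1 <= C * t ^+ 2.
    by rewrite -(@ler_pM2l _ (r ^+ 2)) ?exprn_gt0//; lra.
  have : m ^+ 2 <= 1 by rewrite expr_le1// ltW.
  by rewrite /L; lra.
have vclass : perron_class (fun z => Num.max (perron z) (P z)).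
  split.
  - move=> z; apply: (@continuous_max _ _ perron P); first exact: perron_continuous.
    apply: (@continuousD _ _ _ (fun=> perron y + m ^+ 2) (quad q (- C) y)).
      exact: cst_continuous.
    exact: quad_continuous.
  - apply: (@qsub_max perron P q (- C) y (perron y + m ^+ 2) perron_qsub) => // z zP.
    have zm : enorm (z - y) <= m.
      by rewrite leNgt; apply: contraTN zP => /Pd; rewrite leNgt.
    have := dP (q + (2 * - C) *: (z - y)) z.
    rewrite (_ : _ - q = (2 * - C) *: (z - y)); last by rewrite addrAC subrr add0r.
    rewrite enormZ mulrN normrN gtr0_norm; last by lra.
    have h : 2 * C * enorm (z - y) < d.
      move: mC; rewrite ltr_pdivlMr ?mulr_gt0// => mC.
      by apply: le_lt_trans mC; rewrite mulrC ler_pM2r// mulr_gt0.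
    by move=> /(_ h (le_lt_trans zm md)); rewrite ltr_norml => /andP[_]; lra.
  - rewrite max_l ?perron_center//.
    by rewrite -perron_center Pd// (lt_trans mr)// enormB.
have := perron_ge y vclass; rewrite ge_max => /andP[_].
rewrite /P quad_center => h; have : 0 < m ^+ 2 by rewrite exprn_gt0.
by lra.
Qed.

End Perron.
(** * Comparison *)

Section Comparison.
Variables (R : realType) (n : nat) (F : 'rV[R]_n -> 'rV[R]_n -> R).
Variables (mu mu' K : R).
Hypothesis F_uniform : forall r e, 0 < r -> 0 < e -> exists2 d, 0 < d &
  forall q q' y y', enorm q < r -> enorm q' < r ->
    enorm (q - q') < d -> enorm (y - y') < d -> `|F q y - F q' y'| < e.
Hypothesis F_convex : forall t q q' y, 0 < t -> t < 1 ->
  F (t *: q + (1 - t) *: q') y <= t * F q y + (1 - t) * F q' y.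
Hypothesis K_gt0 : 0 < K.
Hypothesis F_coercive : forall q y, F q y <= mu -> enorm q <= K.
Hypothesis mu'_lt : mu' < mu.
Variables (x0 : 'rV[R]_n) (u w v : 'rV[R]_n -> R).
Hypothesis u_sub : qsub F mu (~` [set x0]) u.
Hypothesis w_sub : qsub F mu' setT w.
Hypothesis v_super : qsuper F mu (~` [set x0]) v.
Variable L : R.
Hypothesis L_gt0 : 0 < L.
Hypothesis u_lipschitz : forall x y, u y <= u x + L * enorm (y - x).
Hypothesis w_lipschitz : forall x y, w y <= w x + L * enorm (y - x).
Hypothesis v_lipschitz : forall x y, v y <= v x + L * enorm (y - x).
Hypotheses (u0 : u x0 = 0) (w0 : w x0 = 0) (v0 : v x0 = 0).
Implicit Types (x y z q : 'rV[R]_n) (t lam eps : R).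

Let V := 'rV[R]_n.

Lemma eball3_max (f : V * V * V -> R) x (r s : R) : 0 <= r -> 0 <= s ->
  continuous f -> exists a b c,
    [/\ enorm (a - x) <= r, enorm (b - x) <= r, enorm (c - x) <= s &
      forall a' b' c', enorm (a' - x) <= r -> enorm (b' - x) <= r ->
        enorm (c' - x) <= s -> f (a', b', c') <= f (a, b, c)].
Proof.
move=> r0 s0 fc.
pose B t := [set z : V | enorm (z - x) <= t].
have [|||[[a b] c] /set_mem[[/= ar br] cs] fmax] :=
    @compact_EVT_max _ R f (B r `*` B r `*` B s).
- by exists (x, x, x); split; [split|]; rewrite /B/= subrr enorm0.
- by apply: compact_setX; [apply: compact_setX|]; exact: eball_compact.
- exact: continuous_subspaceT.
exists a, b, c; split=> // a' b' c' a'r b'r c's.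
by apply: fmax; rewrite inE; split; [split|].
Qed.

(** For fixed [X.2], maximising over the other two components produces the sup-convolutions of [u]
    and [w]. The weights also multiply the quadratic terms, so that the gradients combine convexly
    at [X.2]. *)
Let penalized lam th eps (k : R) (X : V * V * V) : R :=
  lam * (u X.1.1 - enorm (X.1.1 - X.2) ^+ 2 / (2 * th))
  + (1 - lam) * (w X.1.2 - enorm (X.1.2 - X.2) ^+ 2 / (2 * th))
  - v X.2 - eps * (sdist k x0 X.2 - k).

Lemma penalized_continuous lam th eps k : 0 < k ->
  continuous (penalized lam th eps k).
Proof.
move=> k0.
have uc : continuous u by apply: (lipschitz_continuous _ u_lipschitz); exact: ltW.
have wc : continuous w by apply: (lipschitz_continuous _ w_lipschitz); exact: ltW.
have vc : continuous v by apply: (lipschitz_continuous _ v_lipschitz); exact: ltW.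
have c2 : continuous (fun X : V * V * V => X.2) by move=> X; exact: cvg_snd.
have c11 : continuous (fun X : V * V * V => X.1.1).
  by move=> X; apply: (@continuous_comp _ _ _ fst fst); exact: cvg_fst.
have c12 : continuous (fun X : V * V * V => X.1.2).
  by move=> X; apply: (@continuous_comp _ _ _ fst snd); [exact: cvg_fst|exact: cvg_snd].
have sq (f : V * V * V -> V) : continuous f ->
    continuous (fun X => enorm (f X - X.2) ^+ 2 / (2 * th)).
  move=> fc X.
  apply: (@continuousM _ _ (fun X => enorm (f X - X.2) ^+ 2) (fun=> (2 * th)^-1)).
    apply: (@continuous_comp _ _ _ (fun X => enorm (f X - X.2)) (fun t : R => t ^+ 2)).
      apply: (@continuous_comp _ _ _ (fun X => f X - X.2) (@enorm R n)).
        apply: (@continuousB _ _ _ f snd); [exact: fc|exact: c2].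
      have := @enormB_continuous R n 0 (f X - X.2).
      rewrite (_ : (fun z => enorm (z - 0)) = @enorm R n)//.
      by apply/funext => z; rewrite subr0.
    exact: exprn_continuous.
  exact: cst_continuous.
have cM (c : R) (f : V * V * V -> R) : continuous f -> continuous (fun X => c * f X).
  move=> fc X; apply: (@continuousM _ _ (fun=> c) f); last exact: fc.
  exact: cst_continuous.
have cD (f g : V * V * V -> R) : continuous f -> continuous g ->
    continuous (fun X => f X + g X).
  by move=> fc gc X; apply: (@continuousD _ _ _ f g); [exact: fc|exact: gc].
have cN (f : V * V * V -> R) : continuous f -> continuous (fun X => - f X).
  by move=> fc X; apply: continuousN; exact: fc.
have cC (g : V -> R) (f : V * V * V -> V) : continuous g -> continuous f ->
    continuous (fun X => g (f X)).
  by move=> gc fc X; apply: (@continuous_comp _ _ _ f g); [exact: fc|exact: gc].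
have c12v : continuous (fun X : V * V * V => - v X.2) by exact/cN/cC.
have cb : continuous (fun X : V * V * V => - (eps * (sdist k x0 X.2 - k))).
  apply: cN; apply: cM; apply: cD; last by move=> X; exact: cst_continuous.
  by apply: cC => //; exact: sdist_continuous.
have cu : continuous (fun X : V * V * V =>
    lam * (u X.1.1 - enorm (X.1.1 - X.2) ^+ 2 / (2 * th))).
  exact: (cM lam _ (cD _ _ (cC u _ uc c11) (cN _ (sq _ c11)))).
have cw : continuous (fun X : V * V * V =>
    (1 - lam) * (w X.1.2 - enorm (X.1.2 - X.2) ^+ 2 / (2 * th))).
  exact: (cM (1 - lam) _ (cD _ _ (cC w _ wc c12) (cN _ (sq _ c12)))).
exact: (cD _ _ (cD _ _ (cD _ _ cu cw) c12v) cb).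
Qed.

(** The maximum of [L * s - s ^+ 2 / (2 * th)] over [s] is [L ^+ 2 * th / 2]; the difference is a
    perfect square. *)
Lemma supconv_bound (f : V -> R) (th : R) x y : 0 < th ->
  (forall x y, f y <= f x + L * enorm (y - x)) ->
  f x - enorm (x - y) ^+ 2 / (2 * th) <= f y + L ^+ 2 * th / 2.
Proof.
move=> th0 fl; have := fl y x; move: (enorm _) => s h.
rewrite lerBlDr (le_trans h)// -addrA lerD2l -subr_ge0.
rewrite (_ : _ - _ = (L * th - s) ^+ 2 / (2 * th)); last by field; rewrite gt_eqF.
by rewrite divr_ge0 ?sqr_ge0// mulr_ge0// ltW.
Qed.

Lemma supconv_dist (f : V -> R) (th : R) x y : 0 < th ->
  (forall x y, f y <= f x + L * enorm (y - x)) ->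
  f y <= f x - enorm (x - y) ^+ 2 / (2 * th) -> enorm (x - y) <= 2 * L * th.
Proof.
move=> th0 fl h; have := fl y x; have s0 := enorm_ge0 (x - y).
move: (enorm _) s0 h => s s0 h1 h2.
have : s ^+ 2 / (2 * th) <= L * s by lra.
rewrite ler_pdivrMr ?mulr_gt0// => h3.
have [->|s1] := eqVneq s 0; first by rewrite !mulr_ge0// ltW.
have {}s0 : 0 < s by rewrite lt_neqAle eq_sym s1.
by rewrite -(ler_pM2l s0); lra.
Qed.

(** At a maximum point [x] of the sup-convolution, the penalty recentred at [x] is a paraboloid
    touching [f] from above. *)
Lemma supconv_grad (f : V -> R) G Om (m th r : R) x y : 0 < th -> 0 < r ->
  qsub G m Om f -> Om x ->
  (forall z, enorm (z - x) < r -> f z - enorm (z - y) ^+ 2 / (2 * th)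
                                  <= f x - enorm (x - y) ^+ 2 / (2 * th)) ->
  G (th^-1 *: (x - y)) x <= m.
Proof.
move=> th0 r0 fs Ox h; apply: (fs x _ (2 * th)^-1 r) => // z /h.
rewrite (sqr_enorm_expand y x z) /quad dotZl invfM.
by move: th^-1 => i; lra.
Qed.

(** At fixed [y], convexity gives at most [lam * mu + (1 - lam) * mu'], which is below [mu] by
    [(1 - lam) * (mu - mu')]. Moving the base points to [y] costs at most half of this gap, and
    subtracting [eps *: g] less than the other half. *)
Lemma F_combination_lt lam eps d q1 q2 g x x' y : 0 < lam -> lam < 1 ->
  0 < eps -> eps < 1 -> eps < d ->
  (forall q q' y y', enorm q < K + 2 -> enorm q' < K + 2 ->
    enorm (q - q') < d -> enorm (y - y') < d ->
    `|F q y - F q' y'| < (1 - lam) * (mu - mu') / 2) ->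
  F q1 x <= mu -> F q2 x' <= mu' -> enorm (y - x) < d -> enorm (y - x') < d ->
  enorm g <= 1 ->
  F (lam *: q1 + (1 - lam) *: q2 - eps *: g) y < mu.
Proof.
move=> l0 l1 e0 e1 ed Fd Fq1 Fq2 yx yx' g1.
have l1' : 0 < 1 - lam by lra.
have d0 : 0 < d by exact: lt_trans ed.
pose qb := lam *: q1 + (1 - lam) *: q2; rewrite -/qb.
have q1K := F_coercive Fq1.
have q2K := F_coercive (le_trans Fq2 (ltW mu'_lt)).
have qbK : enorm qb <= K.
  apply: le_trans (ler_enormD _ _) _; rewrite !enormZ !gtr0_norm//.
  have := ler_wpM2l (ltW l0) q1K; have := ler_wpM2l (ltW l1') q2K; lra.
have egn : enorm (eps *: g) <= eps by rewrite enormZ gtr0_norm// ler_piMr// ltW.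
have K2 t : t <= K -> t < K + 2 by lra.
have near q z : enorm q <= K -> enorm (y - z) < d ->
    F q y < F q z + (1 - lam) * (mu - mu') / 2.
  move=> qK yz; rewrite -ltrBlDl; apply: le_lt_trans (ler_norm _) _.
  by apply: Fd; rewrite ?subrr ?enorm0 ?K2.
have F1 : F (qb - eps *: g) y < F qb y + (1 - lam) * (mu - mu') / 2.
  rewrite -ltrBlDl; apply: le_lt_trans (ler_norm _) _.
  have qbg : qb - eps *: g - qb = - (eps *: g) by rewrite addrAC subrr add0r.
  apply: Fd; rewrite ?subrr ?enorm0 ?(K2 _ qbK) ?qbg ?enormN ?(le_lt_trans egn)//.
  have := ler_enormD qb (- (eps *: g)); rewrite enormN => h.
  by lra.
have := F_convex q1 q2 y l0 l1; rewrite -/qb.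
have := ltW (near q1 x q1K yx); have := ltW (near q2 x' q2K yx').
move: F1 Fq1 Fq2 l0 l1'.
move: (F qb y) (F _ y) (F q1 y) (F q2 y) (F q1 x) (F q2 x') => a b f1 f2 f3 f4.
move=> hb h3 h4 l0 l1' h2 h1 ha.
have := ler_wpM2l (ltW l0) (le_trans h1 (lerD h3 (lexx _))).
have := ler_wpM2l (ltW l1') (le_trans h2 (lerD h4 (lexx _))).
by lra.
Qed.

(* [eps * (sdist k x0 z - k)] beats the linear growth at infinity for every [k],
   but tends to [0] pointwise as [k] tends to infinity. *)
Lemma perturbed_comparison lam eps d (B k : R) : 0 < lam -> lam < 1 ->
  0 < eps -> eps < 1 -> eps < d -> 0 < k ->
  (forall q q' y y', enorm q < K + 2 -> enorm q' < K + 2 ->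
    enorm (q - q') < d -> enorm (y - y') < d ->
    `|F q y - F q' y'| < (1 - lam) * (mu - mu') / 2) ->
  (forall z, lam * u z + (1 - lam) * w z - v z <= eps / 2 * enorm (z - x0) + B) ->
  forall z, lam * u z + (1 - lam) * w z - v z <= eps * (sdist k x0 z - k).
Proof.
move=> l0 l1 e0 e1 ed k0 Fd growth p; rewrite leNgt; apply/negP => hp.
have l1' : 0 < 1 - lam by lra.
set m := lam * u p + (1 - lam) * w p - v p - eps * (sdist k x0 p - k).
have m0 : 0 < m by rewrite /m; lra.
have L2 : 0 < L ^+ 2 by rewrite exprn_gt0.
have d0 : 0 < d by lra.
(* The three bounds on [th] serve in turn to exclude the outer sphere, to keep the maximum away from
   [x0], and to bring [x] and [x'] within [d] of [y]. *)
have [|th th0 /and4P[th1 thm' thd' _]] :=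
    @exists_pos_lt R [:: 1; m / (6 * L ^+ 2); d / (3 * L)].
  by rewrite /= ltr01 !divr_gt0// mulr_gt0.
have thm : 6 * L ^+ 2 * th < m by rewrite mulrC -ltr_pdivlMr// mulr_gt0.
have thd : 3 * L * th < d by rewrite mulrC -ltr_pdivlMr// mulr_gt0.
have Lth : 0 < L * th by rewrite mulr_gt0.
have Ld : 2 * L * th < d by lra.
have p0 := enorm_ge0 (p - x0).
(* At radius [s] the penalty [eps * s] exceeds the growth [eps / 2 * s + B] by enough to cover
   [eps * k] and the sup-convolution error. *)
pose s := enorm (p - x0) + 2 * (`|B| + eps * k + L ^+ 2) / eps.
have num0 : 0 < 2 * (`|B| + eps * k + L ^+ 2).
  by rewrite mulr_gt0// ltr_pwDr// addr_ge0// mulr_ge0 ?ltW.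
have ps : enorm (p - x0) <= s by rewrite lerDl divr_ge0// ltW.
have s0 : 0 <= s by lra.
have es : `|B| + eps * k + L ^+ 2 <= eps / 2 * s.
  have : eps * s = eps * enorm (p - x0) + 2 * (`|B| + eps * k + L ^+ 2).
    by rewrite /s mulrDr; congr (_ + _); field; rewrite gt_eqF.
  by have := mulr_ge0 (ltW e0) p0; lra.
clearbody s.
(* The copies [x] and [x'] get a larger ball than [y]: being within [2 * L * th] of [y], they keep a
   margin [L * th] for the tests. *)
pose r := s + 3 * L * th.
have rs : r = s + 3 * L * th by [].
have r0 : 0 <= r by lra.
clearbody r.
have [x [x' [y [xr xr' ys Pmax]]]] :=
  @eball3_max (penalized lam th eps k) x0 r s r0 s0 (penalized_continuous k0).
have mP : m <= penalized lam th eps k (x, x', y).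
  have := Pmax p p p ltac:(lra) ltac:(lra) ps.
  by rewrite /penalized/= subrr enorm0 expr0n/= mul0r !subr0.
have yr : enorm (y - x0) <= r by lra.
have xy : enorm (x - y) <= 2 * L * th.
  apply: (supconv_dist (f := u)) => //.
  have := Pmax y x' y yr xr' ys; rewrite /penalized/= subrr enorm0 expr0n/= mul0r subr0.
  by move=> h; rewrite -(ler_pM2l l0); lra.
have xy' : enorm (x' - y) <= 2 * L * th.
  apply: (supconv_dist (f := w)) => //.
  have := Pmax x y y xr yr ys; rewrite /penalized/= subrr enorm0 expr0n/= mul0r subr0.
  by move=> h; rewrite -(ler_pM2l l1'); lra.
have mU : m <= lam * u y + (1 - lam) * w y - v y + L ^+ 2 * th / 2
    - eps * (sdist k x0 y - k).
  have := ler_wpM2l (ltW l0) (supconv_bound x y th0 u_lipschitz).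
  have := ler_wpM2l (ltW l1') (supconv_bound x' y th0 w_lipschitz).
  by move: mP; rewrite /penalized/=; lra.
have L2th : L ^+ 2 * th <= L ^+ 2 by rewrite ger_pMr// ltW.
have {}ys : enorm (y - x0) < s.
  rewrite lt_neqAle ys andbT; apply/eqP => ys'.
  have := growth y; have := ler_norm B.
  have := ler_wpM2l (ltW e0) (sdist_ge_enorm k x0 y); rewrite ys'.
  by move: mU es; lra.
(* All three functions vanish at [x0] and are [L]-Lipschitz, so near [x0] the penalized value is
   below [m]. Hence neither [y] nor [x] is [x0]; the point [x'] is unrestricted because [w] is a
   subsolution everywhere. *)
have far : 2 * L * th < enorm (y - x0).
  rewrite ltNge; apply/negP => yx0.
  have h1 := ler_wpM2l (ltW l0) (u_lipschitz x0 y).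
  have h2 := ler_wpM2l (ltW l1') (w_lipschitz x0 y).
  have h3 := v_lipschitz y x0.
  have h4 := ler_wpM2l (ltW L_gt0) yx0.
  have h5 : 0 <= eps * (sdist k x0 y - k).
    by rewrite mulr_ge0 ?(ltW e0)// subr_ge0 sdist_ge// ltW.
  rewrite u0 w0 v0 (enormB x0) in h1 h2 h3.
  by move: mU m0 thm; nra.
have yx0 : (~` [set x0]) y.
  by move=> /= yx0; move: far; rewrite yx0 subrr enorm0; lra.
have xx0 : (~` [set x0]) x.
  by move=> /= xx0; move: far xy; rewrite xx0 enormB; lra.
pose q1 := th^-1 *: (x - y); pose q2 := th^-1 *: (x' - y).
have Fq1 : F q1 x <= mu.
  apply: (supconv_grad th0 Lth u_sub xx0) => z zx.
  have zr : enorm (z - x0) <= r.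
    by have := ler_enorm_dist x z x0; have := ler_enorm_dist y x x0; lra.
  have := Pmax z x' y zr xr' (ltW ys); rewrite /penalized/=.
  by move=> h; rewrite -(ler_pM2l l0); lra.
have Fq2 : F q2 x' <= mu'.
  apply: (supconv_grad th0 Lth w_sub I) => z zx.
  have zr : enorm (z - x0) <= r.
    by have := ler_enorm_dist x' z x0; have := ler_enorm_dist y x' x0; lra.
  have := Pmax x z y xr zr (ltW ys); rewrite /penalized/=.
  by move=> h; rewrite -(ler_pM2l l1'); lra.
pose b := sdist k x0 y.
have b0 : 0 < b by exact: sdist_gt0.
pose g := b^-1 *: (y - x0).
have g1 : enorm g <= 1 by exact: enorm_grad_sdist.
pose qb := lam *: q1 + (1 - lam) *: q2.
(* With [x] and [x'] frozen, maximality in the last variable places a paraboloid below [v]; the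
   bound on [sdist] from above makes it explicit. *)
have Fqb : mu <= F (qb - eps *: g) y.
  apply: (v_super (y := y) (c := - (eps * (2 * b)^-1 + (2 * th)^-1))
    (r := s - enorm (y - x0))) => //; first by rewrite subr_gt0.
  move=> z zy; have zs : enorm (z - x0) <= s.
    by have := ler_enorm_dist y z x0; lra.
  have := Pmax x x' z xr xr' zs; rewrite /penalized/=.
  have := ler_wpM2l (ltW e0) (sdist_upper x0 y z k0); rewrite -/b -/g.
  rewrite /quad (dotDl qb) dotNl (dotZl eps) (dotDl (lam *: q1)).
  rewrite !(dotZl _ q1) !(dotZl _ q2).
  rewrite !(dotZl th^-1) !(enormB _ z) (sqr_enorm_expand x y z).
  rewrite (sqr_enorm_expand x' y z) (enormB x) (enormB x').
  rewrite -!(opprB y x) -!(opprB y x') !dotNl !invfM.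
  move: (th^-1) (b^-1) => i j.
  by lra.
rewrite enormB in xy; rewrite enormB in xy'.
have := F_combination_lt l0 l1 e0 e1 ed Fd Fq1 Fq2
  (le_lt_trans xy Ld) (le_lt_trans xy' Ld) g1.
by rewrite ltNge Fqb.
Qed.

Lemma comparison_step lam eps d (B : R) : 0 < lam -> lam < 1 ->
  0 < eps -> eps < 1 -> eps < d ->
  (forall q q' y y', enorm q < K + 2 -> enorm q' < K + 2 ->
    enorm (q - q') < d -> enorm (y - y') < d ->
    `|F q y - F q' y'| < (1 - lam) * (mu - mu') / 2) ->
  (forall z, lam * u z + (1 - lam) * w z - v z <= eps / 2 * enorm (z - x0) + B) ->
  forall z, lam * u z + (1 - lam) * w z <= v z.
Proof.
move=> l0 l1 e0 e1 ed Fd growth z; rewrite -subr_le0; apply/ler_addgt0Pr => e e'0.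
rewrite add0r; set s := enorm (z - x0).
(* Since [sdist k x0 z - k] is at most [s ^+ 2 / (2 * k)], this [k] brings it below [e]. *)
pose k := 1 + s ^+ 2 / (2 * e).
have k0 : 0 < k by rewrite ltr_pwDl// divr_ge0 ?sqr_ge0// mulr_ge0// ltW.
apply: (le_trans (perturbed_comparison l0 l1 e0 e1 ed k0 Fd growth z)).
have := sdist_upper x0 x0 z k0; rewrite /quad sdist_center ?(ltW k0)//.
rewrite subrr scaler0 dot0l add0r -/s => h.
have : (2 * k)^-1 * s ^+ 2 <= e.
  rewrite ler_pdivrMl ?mulr_gt0// /k mulrDr mulrDl mulr1.
  rewrite (_ : 2 * (s ^+ 2 / (2 * e)) * e = s ^+ 2); last by field; rewrite gt_eqF.
  by lra.
move=> h'; apply: (@le_trans _ _ (sdist k x0 z - k)); last by lra.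
by rewrite ler_piMl ?subr_ge0 ?sdist_ge// ltW.
Qed.

Hypothesis w_growth : forall e, 0 < e -> exists B, forall z,
  w z - v z <= e * enorm (z - x0) + B.

(** The parameter climbs from 0 to [lam] in [N] equal steps. As [1 - t k.+1 >= 1 - lam], the modulus
    [d] found for [lam] serves every step, so the step length stays fixed. *)
Lemma comparison_convex lam z : 0 < lam -> lam < 1 ->
  lam * u z + (1 - lam) * w z <= v z.
Proof.
move=> l0 l1.
have muK := mu'_lt; have K2 : 0 < K + 2 by have := K_gt0; lra.
have sig0 : 0 < (1 - lam) * (mu - mu') / 2 by rewrite divr_gt0// mulr_gt0 ?subr_gt0.
have [d d0 Fd] := F_uniform K2 sig0.
have [|eps e0 /and3P[e1 ed _]] := @exists_pos_lt R [:: 1; d].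
  by rewrite /= ltr01 d0.
have e4 : 0 < eps / 4 by rewrite divr_gt0.
have [B0 hB0] := w_growth e4.
(* One step adds linear growth at most [2 * L / N <= eps / 4]; with the [eps / 4] already present
   this is the [eps / 2] accepted by [comparison_step]. *)
pose N := (Num.truncn (8 * L / eps)).+1.
have N0 : 0 < N%:R :> R by rewrite ltr0n.
have NL : 8 * L < eps * N%:R.
  by rewrite [ltRHS]mulrC -ltr_pdivrMr//; exact: truncnS_gt.
pose t k : R := k%:R / N%:R * lam.
have uw x : u x - w x <= 2 * L * enorm (x - x0).
  have := u_lipschitz x0 x; have := w_lipschitz x x0.
  by rewrite u0 w0 (enormB x0); lra.
have step k : (k < N)%N ->
    (exists B, forall x, t k * u x + (1 - t k) * w x - v x
       <= eps / 4 * enorm (x - x0) + B) ->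
    forall x, t k.+1 * u x + (1 - t k.+1) * w x <= v x.
  move=> kN [B hB].
  have tl : t k.+1 <= lam.
    by rewrite /t ler_piMl ?(ltW l0)// ler_pdivrMr// mul1r ler_nat.
  have t0 : 0 < t k.+1 by rewrite /t mulr_gt0// divr_gt0// ltr0n.
  apply: (@comparison_step _ eps d B) => //; first by lra.
    move=> q q' y y' hq hq' hqq' hyy'.
    apply: lt_le_trans (Fd q q' y y' hq hq' hqq' hyy') _.
    by rewrite !ler_pM2r//; lra.
  move=> x; have := hB x; have := uw x.
  have -> : t k.+1 = t k + N%:R^-1 * lam.
    by rewrite /t -natr1 mulrDl mulrDl mul1r.
  have s0 := enorm_ge0 (x - x0).
  have h1 : N%:R^-1 * lam * (2 * L) <= eps / 4.
    have : N%:R^-1 * (2 * L) <= eps / 4 by rewrite ler_pdivrMl//; lra.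
    apply: le_trans; rewrite -mulrA mulrCA ler_piMl ?(ltW l1)//.
    by rewrite mulr_ge0 ?invr_ge0 ?mulr_ge0 ?ltW ?L_gt0.
  have a0 : 0 <= N%:R^-1 * lam by rewrite mulr_ge0 ?invr_ge0 ?ltW.
  move: (N%:R^-1 * lam) (t k) a0 h1 => a b a0 h1 h2 h3.
  have := ler_wpM2l a0 h2; have := ler_wpM2r s0 h1; lra.
have all k : (k < N)%N -> forall x, t k.+1 * u x + (1 - t k.+1) * w x <= v x.
  elim: k => [|k IH] kN; apply: step => //.
    by exists B0 => x; rewrite /t mul0r mul0r; have := hB0 x; lra.
  exists 0 => x; have := IH (ltnW kN) x.
  by have := mulr_ge0 (ltW e4) (enorm_ge0 (x - x0)); lra.
have := all N.-1 (leqnn _) z.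
by rewrite /t divff ?gt_eqF// mul1r.
Qed.

Lemma comparison z : u z <= v z.
Proof.
apply/ler_addgt0Pr => e e0.
pose D := `|u z - w z| + 1; have D0 : 0 < D by rewrite ltr_pwDr.
have [|s s0 /and3P[s1 sD' _]] := @exists_pos_lt R [:: 1; e / D].
  by rewrite /= ltr01 divr_gt0.
have sD : s * D < e by rewrite -ltr_pdivlMr.
have := @comparison_convex (1 - s) z ltac:(lra) ltac:(lra).
have := ler_norm (u z - w z); move: sD; rewrite /D; nra.
Qed.

End Comparison.
(** * Solutions of the equation *)

Section ShiftedHamiltonian.
Variables (R : realType) (n : nat) (H : 'rV[R]_n -> 'rV[R]_n -> R).
Implicit Types (x y z p q : 'rV[R]_n).

Lemma at_inftyP (P : 'rV[R]_n -> Prop) :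
  at_infty P <-> exists M, forall y, M < enorm y -> P y.
Proof.
split=> [[M _ h]|[M h]]; first by exists M => y; exact: h.
by exists M => // y; exact: h.
Qed.

Lemma coercive_bound (M : R) : coercive H ->
  exists2 K, 0 < K & forall p y, H p y <= M -> enorm p <= K.
Proof.
move=> /cvgeyPgt/(_ M)/at_inftyP[K hK]; exists (`|K| + 1).
  by rewrite ltr_pwDr.
move=> p y hp; rewrite leNgt; apply/negP => Kp.
have /hK : K < enorm p by have := ler_norm K; lra.
apply/negP; rewrite -leNgt; apply: (@le_trans _ _ (H p y)%:E).
  by apply: ereal_inf_lbound; exists y.
by rewrite lee_fin.
Qed.

Lemma shift_uniform p : unif_continuous_on_strips H ->
  forall r e, 0 < r -> 0 < e -> exists2 d, 0 < d &
  forall q q' y y', enorm q < r -> enorm q' < r ->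
    enorm (q - q') < d -> enorm (y - y') < d -> `|H (p + q) y - H (p + q') y'| < e.
Proof.
move=> Hu r e r0 e0; have p0 := enorm_ge0 p.
have [d d0 hd] := Hu (enorm p + r) ltac:(lra) e e0.
exists d => // q q' y y' hq hq' hqq' hyy'; apply: hd => //.
- by have := ler_enormD p q; lra.
- by have := ler_enormD p q'; lra.
- by rewrite opprD addrACA subrr add0r.
Qed.

Lemma shift_continuous p : unif_continuous_on_strips H ->
  econtinuous (fun q y => H (p + q) y).
Proof.
move=> Hu q y e e0; have q0 := enorm_ge0 q.
have [d d0 hd] := @shift_uniform p Hu (enorm q + 1) e ltac:(lra) e0.
exists (Num.min 1 d); first by rewrite lt_min ltr01.
move=> q' y'; rewrite !lt_min => /andP[qq1 qqd] /andP[_ yyd].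
apply: hd => //; last lra.
by have := ler_enormD (q' - q) q; rewrite subrK; lra.
Qed.

Lemma shift_convex p : (forall y, convex_function setT (fun p => H p y)) ->
  forall t q q' y, 0 < t -> t < 1 ->
  H (p + (t *: q + (1 - t) *: q')) y <= t * H (p + q) y + (1 - t) * H (p + q') y.
Proof.
move=> Hc t q q' y t0 t1.
have := Hc y (Itv01 (ltW t0) (ltW t1)) (p + q) (p + q').
rewrite !inE => /(_ I I) h.
rewrite (_ : p + _ = t *: (p + q) + (1 - t) *: (p + q')); first exact: h.
by rewrite !scalerDr addrACA -scalerDl (addrC t) subrK scale1r.
Qed.

Definition sublinear (w : 'rV[R]_n -> R) : Prop := forall e, 0 < e ->
  exists M, forall y, M < enorm y -> `|w y| <= e * enorm y.

(** A level above the infimum leaves room for an admissible [mu'] strictly below it; the gap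
    [mu - mu'] drives both existence and uniqueness. *)
Lemma Hbar_subsolution p (mu : R) : (Hbar H p < mu%:E)%E ->
  exists mu' w, [/\ mu' < mu, continuous w, sublinear w &
    qsub (fun q y => H (p + q) y) mu' setT w].
Proof.
move=> /ereal_inf_lt[_ [mu' [w [[L wL] wlim wsub]] <-]]; rewrite lte_fin => mumu.
exists mu', w; split => //.
- apply: (@lipschitz_continuous _ _ _ `|L|) => // x y.
  have := le_trans (ler_norm _) (wL y x).
  by have := ler_wpM2r (enorm_ge0 (y - x)) (ler_norm L); lra.
- move=> e e0.
  have /cvgrPdist_le/(_ e e0)/at_inftyP[M hM] := wlim.
  exists (Num.max 0 M) => y; rewrite gt_max => /andP[y0 /hM].
  rewrite sub0r normrN normrM gtr0_norm ?invr_gt0//.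
  by rewrite ler_pdivrMl// mulrC.
- exact: viscosity_qsub.
Qed.

Lemma sublinear_shift w x0 : sublinear w -> forall e, 0 < e ->
  exists M, forall y, M < enorm y -> `|w y - w x0| <= e * enorm (y - x0).
Proof.
move=> ws e e0; have [M hM] := ws (e / 2) ltac:(lra).
pose C := `|w x0| + e * enorm x0.
have C0 : 0 <= C by rewrite addr_ge0// mulr_ge0 ?enorm_ge0// ltW.
exists (Num.max M (2 * C / e)) => y; rewrite gt_max => /andP[/hM h].
rewrite ltr_pdivrMr// => hC.
have := ler_enormD (y - x0) x0; rewrite subrK => h1.
have := ler_wpM2l (ltW e0) h1; have := ler_normB (w y) (w x0).
by move: hC; rewrite /C; lra.
Qed.

(** By convexity of [sdist], a test of the sum with gradient [q] is a test of [w] with gradient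
    [q - eps *: g]. Coercivity bounds the latter, and uniform continuity keeps the increase of [H]
    below [mu - mu']. *)
Lemma bump_subsolution p (mu mu' : R) w x0 : unif_continuous_on_strips H ->
  coercive H -> mu' < mu -> continuous w ->
  qsub (fun q y => H (p + q) y) mu' setT w ->
  exists2 eps, 0 < eps & perron_class (fun q y => H (p + q) y) mu x0
    (fun z => w z - w x0 + eps * (sdist 1 x0 z - 1)).
Proof.
move=> Hu Hc mumu wc ws.
have [K K0 hK] := coercive_bound mu' Hc.
have p0 := enorm_ge0 p.
have [d d0 hd] := @shift_uniform p Hu (K + enorm p + 2) (mu - mu') ltac:(lra) ltac:(lra).
have [|eps e0 /and3P[e1 ed _]] := @exists_pos_lt R [:: 1; d].
  by rewrite /= ltr01 d0.
exists eps => //; split.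
- move=> z; apply: (@continuousD _ _ _ (fun z => w z - w x0)
      (fun z => eps * (sdist 1 x0 z - 1))).
    apply: (@continuousB _ _ _ w (fun=> w x0)); first exact: wc.
    exact: cst_continuous.
  apply: (@continuousM _ _ (fun=> eps) (fun z => sdist 1 x0 z - 1)).
    exact: cst_continuous.
  apply: (@continuousB _ _ _ (sdist 1 x0) (fun=> 1)); last exact: cst_continuous.
  exact: sdist_continuous.
- move=> y q c r r0 _ hy.
  have b0 : 0 < sdist 1 x0 y by exact: sdist_gt0.
  set g := (sdist 1 x0 y)^-1 *: (y - x0).
  have g1 : enorm (eps *: g) <= eps.
    by rewrite enormZ gtr0_norm// ler_piMr ?(ltW e0)// enorm_grad_sdist.
  have hq : H (p + (q - eps *: g)) y <= mu'.
    apply: (ws y _ c r) => // z /hy.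
    have := ler_wpM2l (ltW e0) (sdist_lower x0 y z (@ltr01 R)); rewrite -/g.
    by rewrite /quad (dotDl q) dotNl (dotZl eps); lra.
  have qK : enorm (q - eps *: g) <= K + enorm p.
    have := hK _ _ hq; have := ler_enormD (p + (q - eps *: g)) (- p).
    rewrite (_ : p + (q - eps *: g) - p = q - eps *: g) ?enormN; last first.
      by rewrite addrAC subrr add0r.
    lra.
  have : `|H (p + q) y - H (p + (q - eps *: g)) y| < mu - mu'.
    apply: hd.
    - by have := ler_enormD (q - eps *: g) (eps *: g); rewrite subrK; lra.
    - lra.
    - by rewrite opprB addrCA subrr addr0; lra.
    - by rewrite subrr enorm0.
  by rewrite ltr_norml => /andP[_]; lra.
- by rewrite sdist_center// !subrr mulr0 addr0.
Qed.

(** This sign near infinity is what starts the comparison at [lam = 0]. *)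
Lemma liminf_pos_eventually (d : 'rV[R]_n -> R) :
  (0 < limf_einf (fun y => ((enorm y)^-1 * d y)%:E) at_infty)%E ->
  exists M, forall y, M < enorm y -> 0 <= d y.
Proof.
rewrite limf_einfE => /ereal_sup_gt[_ [A /at_inftyP[M hM] <-]] h.
exists (Num.max 0 M) => y; rewrite gt_max => /andP[y0 /hM Ay].
have : (0 < ((enorm y)^-1 * d y)%:E)%E.
  by apply: (lt_le_trans h); apply: ereal_inf_lbound; exists y.
by rewrite lte_fin pmulr_rgt0 ?invr_gt0// => /ltW.
Qed.

Lemma eventually_liminf_pos (d : 'rV[R]_n -> R) (a M : R) : 0 < a ->
  (forall y, M < enorm y -> a * enorm y <= d y) ->
  (0 < limf_einf (fun y => ((enorm y)^-1 * d y)%:E) at_infty)%E.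
Proof.
move=> a0 h; apply: (@lt_le_trans _ _ a%:E); first by rewrite lte_fin.
rewrite limf_einfE; apply: (@le_trans _ _ (ereal_inf
  [set ((enorm y)^-1 * d y)%:E | y in [set y | Num.max 0 M < enorm y]])).
  apply: le_ereal_inf_tmp => _ [y /= + <-].
  rewrite gt_max => /andP[y0 /h dy].
  by rewrite lee_fin ler_pdivlMl// mulrC.
apply: ereal_sup_ubound; exists [set y | Num.max 0 M < enorm y] => //.
by exists (Num.max 0 M).
Qed.

Lemma solution_le p (mu : R) x0 d e :
  unif_continuous_on_strips H -> (forall y, convex_function setT (fun p => H p y)) ->
  coercive H -> (Hbar H p < mu%:E)%E ->
  continuous d -> continuous e -> d x0 = 0 -> e x0 = 0 ->
  qsub (fun q y => H (p + q) y) mu (~` [set x0]) d ->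
  qsub (fun q y => H (p + q) y) mu (~` [set x0]) e ->
  qsuper (fun q y => H (p + q) y) mu (~` [set x0]) e ->
  (exists M, forall y, M < enorm y -> 0 <= e y) ->
  forall z, d z <= e z.
Proof.
move=> Hu Hv Hc /Hbar_subsolution[mu' [w [mumu wc wlin wsub]]].
move=> dc ec d0 e0 dsub esub esup [M1 eM].
pose F q y := H (p + q) y.
have [K0 K00 hK] := coercive_bound mu Hc.
pose K := K0 + enorm p.
have K1 : 0 < K by rewrite ltr_pwDl// enorm_ge0.
have FK q y : F q y <= mu -> enorm q <= K.
  move=> /hK h; have := ler_enormD (p + q) (- p).
  by rewrite enormN addrAC subrr add0r /K; lra.
pose W z := w z - w x0.
have Wc : continuous W.
  move=> z; apply: (@continuousB _ _ _ w (fun=> w x0)); first exact: wc.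
  exact: cst_continuous.
have Wsub : qsub F mu' setT W.
  by move=> y q c r r0 _ h; apply: (wsub y q c r) => // z /h; rewrite /W; lra.
have Wsub0 : qsub F mu (~` [set x0]) W.
  move=> y q c r r0 _ h; apply: ltW; apply: le_lt_trans mumu.
  exact: (Wsub y q c r).
have lip f := @qsub_lipschitz R n F mu K K1 FK x0 f.
have L0 : 0 < 2 * K by lra.
apply: (@comparison R n F mu mu' K _ _ K1 FK mumu x0 d W e dsub Wsub esup (2 * K)) => //.
- by move=> r s; exact: shift_uniform.
- by move=> t q q' y; exact: shift_convex.
- exact: lip.
- exact: lip.
- exact: lip.
- by rewrite /W subrr.
move=> s s0; have [M2 hM2] := sublinear_shift x0 wlin s0.
(* Inside radius [|M1| + |M2|] the Lipschitz bounds of [W] and [e], each with constant [2 * K], give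
   the estimate; outside, [e] is nonnegative and [W] is sublinear. *)
exists (4 * K * (`|M1| + `|M2| + enorm x0)) => z.
have z0 := enorm_ge0 (z - x0); have x00 := enorm_ge0 x0.
have [zM|zM] := leP (enorm z) (`|M1| + `|M2|).
  have := lip _ Wc Wsub0 x0 z; have := lip _ ec esub z x0.
  rewrite /W e0 subrr (enormB x0) => h1 h2.
  have : enorm (z - x0) <= `|M1| + `|M2| + enorm x0.
    by have := ler_enormD z (- x0); rewrite enormN; lra.
  move=> h3; have := ler_wpM2l (ltW L0) h3; have := mulr_ge0 (ltW s0) z0.
  by lra.
have h1 : 0 <= e z by apply: eM; have := ler_norm M1; have := normr_ge0 M2; lra.
have /hM2 h2 : M2 < enorm z by have := ler_norm M2; have := normr_ge0 M1; lra.
have : 0 <= 4 * K * (`|M1| + `|M2| + enorm x0).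
  by apply: mulr_ge0; [rewrite mulr_ge0// ltW|rewrite !addr_ge0].
have := ler_norm (w z - w x0); rewrite -/(W z) in h2 *; lra.
Qed.

End ShiftedHamiltonian.

(** * Existence from the Perron function, uniqueness from comparison in both directions *)

Unset Implicit Arguments.

Theorem proposition3p4 (R : realType) (n : nat) (n_gt0 : (0 < n)%N)
    (H : 'rV[R]_n -> 'rV[R]_n -> R)
    (H_continuous : continuous (fun z : 'rV[R]_n * 'rV[R]_n => H z.1 z.2))
    (H_convex : forall y : 'rV[R]_n, convex_function setT (fun p => H p y))
    (H_coercive : coercive H)
    (H_unif_continuous : unif_continuous_on_strips H)
    (H_bounded : bounded_on_strips H)
    (p : 'rV[R]_n) (mu : R) (mu_gt : (Hbar H p < mu%:E)%E) (x0 : 'rV[R]_n) :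
  exists! d : 'rV[R]_n -> R,
    [/\ continuous d,
        viscosity_solution (fun q y => H (p + q) y) mu (~` [set x0]) d,
        (0 < limf_einf (fun y => ((enorm y)^-1 * d y)%:E) at_infty)%E &
        d x0 = 0].
Proof.
pose F q y := H (p + q) y.
have Fc : econtinuous F by exact: shift_continuous.
have Oo := @eopen_punctured R n x0.
have [K0 K00 hK] := coercive_bound mu H_coercive.
have K1 : 0 < K0 + enorm p by rewrite ltr_pwDl// enorm_ge0.
have FK q y : F q y <= mu -> enorm q <= K0 + enorm p.
  move=> /hK h; have := ler_enormD (p + q) (- p).
  by rewrite enormN addrAC subrr add0r; lra.
have [mu' [w [mumu wc wlin wsub]]] := Hbar_subsolution mu_gt.
have [eps eps0 v0P] := bump_subsolution x0 H_unif_continuous H_coercive mumu wc wsub.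
pose d := perron F mu x0.
have dc : continuous d := perron_continuous K1 FK v0P.
have dsub := perron_qsub Fc K1 FK v0P; have dsup := perron_qsuper Fc K1 FK v0P.
have d0 := perron_center K1 FK v0P.
have dinf : (0 < limf_einf (fun y => ((enorm y)^-1 * d y)%:E) at_infty)%E.
  have e4 : 0 < eps / 4 by lra.
  have [M hM] := sublinear_shift x0 wlin e4.
  have x00 := enorm_ge0 x0.
  (* The bump grows like [eps * enorm (y - x0)] and [w] takes away at most a quarter of it; beyond
     this threshold the shift by [x0] and the constant [eps] still leave [eps / 4 * enorm y]. *)
  apply: (@eventually_liminf_pos _ _ _ (eps / 4) (Num.max M (2 * enorm x0 + 2))) => //.
  move=> y; rewrite gt_max => /andP[/hM + yx]; rewrite ler_norml => /andP[h _].
  have := perron_ge K1 FK v0P y v0P; rewrite -/d.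
  have := ler_wpM2l (ltW eps0) (sdist_ge_enorm 1 x0 y).
  have := ler_enormD (y - x0) x0; rewrite subrK => h1.
  have h2 := ler_wpM2l (ltW eps0) h1; have h3 := ler_wpM2l (ltW eps0) (ltW yx).
  by have := mulr_ge0 (ltW eps0) x00; lra.
exists d; split.
  split=> //; split; first exact: (qsub_viscosity Fc Oo dc dsub).
  exact: (qsuper_viscosity Fc Oo dc dsup).
move=> e [ec [esub esup] einf e0]; apply/funext => z; apply/eqP.
rewrite eq_le; apply/andP; split.
  apply: (solution_le H_unif_continuous H_convex H_coercive mu_gt dc ec d0 e0) => //.
  - exact: viscosity_qsub.
  - exact: viscosity_qsuper.
  - exact: liminf_pos_eventually.
apply: (solution_le H_unif_continuous H_convex H_coercive mu_gt ec dc e0 d0) => //.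
  exact: viscosity_qsub.
exact: liminf_pos_eventually.
Qed.
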